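(* Let $M$ be a 7-dimensional Riemannian manifold with holonomy contained in $G_2$, let $Y\subset M$ be an associative submanifold with boundary $\partial Y$ and normal bundle $\nu$, and let $n$ be the inner unit vector field normal to $\partial Y$ in $Y$. Let $L$ be a real plane subbundle (real rank 2) of $\nu|_{\partial Y}$ invariant under the action of $n\times$. For a local orthonormal frame $\{v,w=n\times v\}$ of $T\partial Y$ define $$\mathcal D_L:\Gamma(\partial Y,L)\to\Gamma(\partial Y,L),\qquad \mathcal D_L\psi=\pi_L\big(v\times\nabla^\perp_w\psi-w\times\nabla^\perp_v\psi\big),$$ where $\pi_L$ is the orthogonal projection onto $L$. Then $\mathcal D_L$ is independent of the chosen oriented frame, is a differential operator of order $0$ (i.e. it is given by a bundle endomorphism of $L$), and is symmetric.
   Context: $M$ carries a parallel nondegenerate 3-form $\phi$ (the $G_2$-form, inducing the metric $\langle\cdot,\cdot\rangle$), and a vector product $\times$ on $TM$ defined by $\langle u\times v,w\rangle=\phi(u,v,w)$. A 3-dimensional submanifold $Y$ is associative if $TY$ is stable under $\times$; then $TY\times\nu\subset\nu$, where $\nu$ is the normal bundle of $Y$ in $M$. $\nabla^\perp$ is the normal connection on $\nu$ induced by the Levi-Civita connection of $M$. *)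

(* Defs.v *)
From HB Require Import structures.
From mathcomp Require Import all_boot all_order all_algebra.
From mathcomp Require Import all_classical all_reals all_analysis.
Import Order.TTheory GRing.Theory Num.Theory.
Import numFieldNormedType.Exports.

Set Implicit Arguments.
Unset Strict Implicit.
Unset Printing Implicit Defensive.

Local Open Scope classical_set_scope.
Local Open Scope ring_scope.

Section Smooth.
Context {R : realType}.
Implicit Types (A : set 'rV[R]_7) (f : 'rV[R]_7 -> R).

(* Meaningful for open A: f is k times continuously differentiable on A. *)
Fixpoint Ck (k : nat) A f : Prop :=
  match k with
  | 0 => forall x, A x -> {for x, continuous f}
  | k'.+1 => (forall x, A x -> differentiable f x) /\
             forall i : 'I_7, Ck k' A (fun x => 'D_(delta_mx 0 i) f x)
  end.

Definition smooth_on A f : Prop := forall k, Ck k A f.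

End Smooth.

(* cmap and cinv are total functions; their values outside of cdom and of
   cmap @` cdom are irrelevant. *)
Record chart (R : realType) (T : topologicalType) := Chart {
  cdom : set T;
  cmap : T -> 'rV[R]_7;
  cinv : 'rV[R]_7 -> T;
  cdom_open : open cdom;
  cimg_open : open (cmap @` cdom);
  cmapK : forall p, cdom p -> cinv (cmap p) = p;
  cmap_continuous : forall p, cdom p -> {for p, continuous cmap};
  cinv_continuous : forall x, (cmap @` cdom) x -> {for x, continuous cinv}
}.

Definition smooth_transition (R : realType) (T : topologicalType)
    (c c' : chart R T) : Prop :=
  forall i : 'I_7,
    smooth_on (cmap c @` (cdom c `&` cdom c'))
              (fun x => cmap c' (cinv c x) 0 i).

(* Smooth 7-manifolds without boundary. *)
Record manifold7 (R : realType) := Manifold7 {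
  mcarrier :> topologicalType;
  m_hausdorff : hausdorff_space mcarrier;
  m_second_countable : @second_countable mcarrier;
  atlas : set (chart R mcarrier);
  atlas_cover : forall p, exists c, atlas c /\ cdom c p;
  atlas_smooth : forall c c', atlas c -> atlas c' -> smooth_transition c c';
  atlas_maximal : forall c,
    (forall c', atlas c' -> smooth_transition c c' /\ smooth_transition c' c) ->
    atlas c
}.
Arguments atlas {R} m.

Section Calculus.
Context {R : realType} {M : manifold7 R}.
Implicit Types (p q : M) (u v w : 'rV[R]_7) (f : M -> R) (X : M -> 'rV[R]_7).

Definition chart_at p : chart R M := projT1 (cid (atlas_cover p)).

(* The tangent space T_pM is 'rV[R]_7, through the coordinates of the preferred
   chart chart_at p; hence vector fields are functions M -> 'rV[R]_7, but their
   smoothness cannot be read off from this expression (chart_at p may vary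
   wildly with p) and is expressed below through their action on functions. *)

(* v f, the derivative at p of f in the direction of the tangent vector v *)
Definition dirder p v f : R :=
  'D_v (f \o cinv (chart_at p)) (cmap (chart_at p) p).

Definition smooth_fun (U : set M) f : Prop :=
  forall c, atlas M c -> smooth_on (cmap c @` (U `&` cdom c)) (f \o cinv c).

Definition smooth_near p f : Prop :=
  exists U : set M, [/\ open U, U p & smooth_fun U f].

(* X is a smooth vector field on some neighbourhood of p *)
Definition smooth_vf p X : Prop :=
  forall f, smooth_near p f -> smooth_near p (fun q => dirder q (X q) f).

(* X, of which only the values on S matter, is smooth near p as a section of
   TM|_S, i.e. it extends to a smooth vector field near p in M. *)
Definition smooth_along (S : set M) p X : Prop :=
  exists Z, smooth_vf p Z /\ \forall q \near p, S q -> Z q = X q.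

(* g p is the Gram matrix of the metric at p in the coordinates of T_pM *)
Definition inner (g : M -> 'M[R]_7) p u v : R := (u *m g p *m v^T) 0 0.

Definition riemannian_metric (g : M -> 'M[R]_7) : Prop :=
  [/\ forall p u v, inner g p u v = inner g p v u,
      forall p u, u != 0 -> 0 < inner g p u u &
      forall p X Y, smooth_vf p X -> smooth_vf p Y ->
        smooth_near p (fun q => inner g q (X q) (Y q))].

(* nabla p v X is the covariant derivative of X at p along v in T_pM; X need
   only be smooth near p (locality follows from the Leibniz rule, applied to
   the indicator function of a neighbourhood). *)
Record affine_connection
    (nabla : forall p, 'rV[R]_7 -> (M -> 'rV[R]_7) -> 'rV[R]_7) : Prop :=
  AffineConnection {
  nabla_linear_l : forall p a u v X, smooth_vf p X ->
    nabla p (a *: u + v) X = a *: nabla p u X + nabla p v X;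
  nabla_add_r : forall p v X Y, smooth_vf p X -> smooth_vf p Y ->
    nabla p v (fun q => X q + Y q) = nabla p v X + nabla p v Y;
  nabla_leibniz : forall p v f X, smooth_near p f -> smooth_vf p X ->
    nabla p v (fun q => f q *: X q) = f p *: nabla p v X + dirder p v f *: X p;
  nabla_smooth : forall p X Y, smooth_vf p X -> smooth_vf p Y ->
    smooth_vf p (fun q => nabla q (X q) Y)
}.

Record levi_civita (g : M -> 'M[R]_7)
    (nabla : forall p, 'rV[R]_7 -> (M -> 'rV[R]_7) -> 'rV[R]_7) : Prop :=
  LeviCivita {
  lc_connection : affine_connection nabla;
  (* nabla_X Y - nabla_Y X = [X, Y], as derivations *)
  lc_torsion_free : forall p X Y f,
    smooth_vf p X -> smooth_vf p Y -> smooth_near p f ->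
    dirder p (nabla p (X p) Y - nabla p (Y p) X) f =
    dirder p (X p) (fun q => dirder q (Y q) f) -
    dirder p (Y p) (fun q => dirder q (X q) f);
  lc_metric : forall p v X Y, smooth_vf p X -> smooth_vf p Y ->
    dirder p v (fun q => inner g q (X q) (Y q)) =
    inner g p (nabla p v X) (Y p) + inner g p (X p) (nabla p v Y)
}.

End Calculus.

(* dx^i /\ dx^j /\ dx^k, with coordinates numbered from 0 to 6 *)
Definition dx3 (R : realType) (i j k : nat) (u v w : 'rV[R]_7) : R :=
  \det (\matrix_(a < 3, b < 3)
          tnth [tuple u; v; w] a 0 (inord (tnth [tuple i; j; k] b))).

(* The standard G2-form on R^7, e123 + e145 + e167 + e246 - e257 - e347 - e356
   in the usual numbering from 1 to 7; it induces the standard metric. *)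
Definition phi0 (R : realType) (u v w : 'rV[R]_7) : R :=
  dx3 0 1 2 u v w + dx3 0 3 4 u v w + dx3 0 5 6 u v w + dx3 1 3 5 u v w
  - dx3 1 4 6 u v w - dx3 2 3 6 u v w - dx3 2 4 5 u v w.

(* A Riemannian 7-manifold with holonomy in G2, presented by its parallel
   nondegenerate 3-form: at each point some linear isomorphism
   u |-> u *m F from R^7 to T_pM carries (phi0, standard metric) to (phi, g).
   This also makes each phi p trilinear and alternating. *)
Record g2_manifold (R : realType) := G2Manifold {
  g2_base :> manifold7 R;
  metric : g2_base -> 'M[R]_7;
  nabla : forall p : g2_base, 'rV[R]_7 -> (g2_base -> 'rV[R]_7) -> 'rV[R]_7;
  phi : g2_base -> 'rV[R]_7 -> 'rV[R]_7 -> 'rV[R]_7 -> R;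
  metric_riemannian : riemannian_metric metric;
  nabla_levi_civita : levi_civita metric nabla;
  phi_nondegenerate : forall p, exists F : 'M[R]_7,
    [/\ F \in unitmx,
        forall u v, inner metric p (u *m F) (v *m F) = (u *m v^T) 0 0 &
        forall u v w, phi p (u *m F) (v *m F) (w *m F) = phi0 u v w];
  phi_smooth : forall p X Y Z,
    smooth_vf p X -> smooth_vf p Y -> smooth_vf p Z ->
    smooth_near p (fun q => phi q (X q) (Y q) (Z q));
  phi_parallel : forall p v X Y Z,
    smooth_vf p X -> smooth_vf p Y -> smooth_vf p Z ->
    dirder p v (fun q => phi q (X q) (Y q) (Z q)) =
    phi p (nabla p v X) (Y p) (Z p) + phi p (X p) (nabla p v Y) (Z p)
    + phi p (X p) (Y p) (nabla p v Z)
}.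

Section Associative.
Context {R : realType} {M : g2_manifold R}.
Implicit Types (p q : M) (u v w a b : 'rV[R]_7) (Y U : set M).
Implicit Types (psi n : M -> 'rV[R]_7) (L : M -> {vspace 'rV[R]_7}).

Definition ip p u v : R := inner (@metric R M) p u v.

Definition cross p u v : 'rV[R]_7 :=
  xget 0 [set z | forall w, ip p z w = phi p u v w].

(* orthogonal projection of T_pM onto its subspace V *)
Definition proj p (V : set 'rV[R]_7) u : 'rV[R]_7 :=
  xget 0 [set z | V z /\ forall a, V a -> ip p (u - z) a = 0].

Definition chart_coord (c : chart R M) (i : 'I_7) q : R := cmap c q 0 i.

(* Charts straightening a 3-dimensional submanifold, resp. a 3-dimensional
   submanifold with boundary, onto {x_3 = ... = x_6 = 0}, resp. onto
   {x_0 >= 0, x_3 = ... = x_6 = 0}. *)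
Definition slice_chart Y (c : chart R M) : Prop :=
  atlas M c /\ forall q, cdom c q ->
    (Y q <-> forall i : 'I_7, (3 <= i)%N -> chart_coord c i q = 0).

Definition half_slice_chart Y (c : chart R M) : Prop :=
  atlas M c /\ forall q, cdom c q ->
    (Y q <-> 0 <= chart_coord c ord0 q /\
             forall i : 'I_7, (3 <= i)%N -> chart_coord c i q = 0).

Definition submanifold3 Y : Prop :=
  forall p, Y p ->
    exists c, cdom c p /\ (slice_chart Y c \/ half_slice_chart Y c).

Definition boundary_chart Y p (c : chart R M) : Prop :=
  [/\ half_slice_chart Y c, cdom c p & chart_coord c ord0 p = 0].

Definition bdry Y : set M :=
  [set p | Y p /\ exists c, boundary_chart Y p c].

Definition tangent Y p : set 'rV[R]_7 :=
  [set v | exists c, [/\ cdom c p, slice_chart Y c \/ half_slice_chart Y c &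
     forall i : 'I_7, (3 <= i)%N -> dirder p v (chart_coord c i) = 0]].

Definition tangent_boundary Y p : set 'rV[R]_7 :=
  [set v | exists c, [/\ boundary_chart Y p c,
     dirder p v (chart_coord c ord0) = 0 &
     forall i : 'I_7, (3 <= i)%N -> dirder p v (chart_coord c i) = 0]].

Definition normal_space Y p : set 'rV[R]_7 :=
  [set u | forall v, tangent Y p v -> ip p u v = 0].

Definition associative_submanifold Y : Prop :=
  submanifold3 Y /\
  forall p, Y p -> forall u v,
    tangent Y p u -> tangent Y p v -> tangent Y p (cross p u v).

Definition inner_unit_normal Y n : Prop :=
  forall p, bdry Y p ->
  [/\ smooth_along (bdry Y) p n,
      tangent Y p (n p),
      ip p (n p) (n p) = 1,
      forall v, tangent_boundary Y p v -> ip p (n p) v = 0 &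
      exists c, boundary_chart Y p c /\
                0 < dirder p (n p) (chart_coord c ord0)].

(* L is a smooth real plane subbundle of the restriction of the normal bundle
   to the boundary *)
Definition normal_plane_bundle Y L : Prop :=
  forall p, bdry Y p ->
  [/\ \dim (L p) = 2%N,
      forall a, a \in L p -> normal_space Y p a &
      exists s1 s2, [/\ smooth_vf p s1, smooth_vf p s2 &
        \forall q \near p, bdry Y q -> L q = <<[:: s1 q; s2 q]>>%VS]].

Definition cross_invariant Y n L : Prop :=
  forall p, bdry Y p -> forall a, a \in L p -> cross p (n p) a \in L p.

(* Gamma(bd Y, L) *)
Definition smooth_section Y L psi : Prop :=
  forall p, bdry Y p -> psi p \in L p /\ smooth_along (bdry Y) p psi.

(* Covariant derivative, along w tangent to the boundary, of a vector field psi
   of M along the boundary: that of any local extension of psi. *)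
Definition nabla_along Y p w psi : 'rV[R]_7 :=
  xget 0 [set z | exists X, [/\ smooth_vf p X,
    \forall q \near p, bdry Y q -> X q = psi q & z = nabla p w X]].

Definition nabla_perp Y p w psi : 'rV[R]_7 :=
  proj p (normal_space Y p) (nabla_along Y p w psi).

(* {v, w = n x v} is an orthonormal frame of the tangent bundle of the boundary
   over its open subset U /\ bd Y *)
Definition oriented_frame Y n U (v w : M -> 'rV[R]_7) : Prop :=
  open U /\ forall q, U q -> bdry Y q ->
  [/\ smooth_along (bdry Y) q v /\ smooth_along (bdry Y) q w,
      tangent_boundary Y q (v q) /\ tangent_boundary Y q (w q),
      ip q (v q) (v q) = 1 /\ ip q (w q) (w q) = 1,
      ip q (v q) (w q) = 0 &
      w q = cross q (n q) (v q)].

Definition DL_frame Y L (v w : M -> 'rV[R]_7) psi p : 'rV[R]_7 :=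
  proj p (fun a => a \in L p)
    (cross p (v p) (nabla_perp Y p (w p) psi)
     - cross p (w p) (nabla_perp Y p (v p) psi)).

(* The operator D_L, computed at each p in some oriented frame around p; that
   the frame does not matter is part of what is to be proved. *)
Definition DL Y n L psi p : 'rV[R]_7 :=
  xget 0 [set z | exists U (v w : M -> 'rV[R]_7),
    [/\ oriented_frame Y n U v w, U p & z = DL_frame Y L v w psi p]].

(* Smooth endomorphisms of L; only the restriction of a |-> a *m A p to L p is
   relevant. *)
Definition bundle_endomorphism Y L (A : M -> 'M[R]_7) : Prop :=
  forall p, bdry Y p ->
    (forall a, a \in L p -> a *m A p \in L p) /\
    forall psi, smooth_along (bdry Y) p psi ->
      (\forall q \near p, bdry Y q -> psi q \in L q) ->
      smooth_along (bdry Y) p (fun q => psi q *m A q).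

End Associative.

(* Main.v *)
Require Import Defs.
From mathcomp Require Import all_boot all_order all_algebra.
From mathcomp Require Import all_classical all_reals all_analysis.
From mathcomp Require Import ring lra.
Import Order.TTheory GRing.Theory Num.Theory.
Import numFieldNormedType.Exports.
Import Defs.
Set Implicit Arguments.
Unset Strict Implicit.
Unset Printing Implicit Defensive.
Local Open Scope classical_set_scope.
Local Open Scope ring_scope.

(** Write phi for the 3-form, so that <u x v, w> = phi(u, v, w), and let psi, chi be
    sections of L.

    The algebraic reason is that a vector u orthogonal to n satisfies
    phi(u, psi, chi) = 0. Indeed L is spanned by e and n x e for any nonzero e in
    L; now u x e is orthogonal to e, and the identity
    <e x u, e x n> = |e|^2 <u, n> - <e, u> <e, n> shows that it is orthogonal to
    n x e as well (phi_complex_line, phi_plane). Also, v x and w x preserve TY,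
    which is orthogonal to L, so that both projections disappear from the
    bilinear form of D_L (DL_frameP):
      <D_L psi, chi> = phi(v, nabla_w psi, chi) - phi(w, nabla_v psi, chi).

    Differentiate phi(v, psi, chi) = 0 along w and phi(w, psi, chi) = 0 along v.
    As phi is parallel and nabla has no torsion, the difference of the results is
      <D_L psi, chi> - <psi, D_L chi> = phi([v, w], psi, chi),
    which vanishes because [v, w] is tangent to the boundary, hence orthogonal
    to n (DL_form_symmetric). So D_L is symmetric, and symmetry implies that it
    has order 0: <D_L psi, e> = <psi, D_L e> does not involve the derivatives of
    psi (DL_frame_value). With an orthonormal frame (e, n x e) of L near a point,
    this gives a smooth matrix for D_L. Two oriented frames (v, w) differ by a
    rotation and the bilinear form is alternating in (v, w), whence the
    independence of the frame (DL_frame_independent).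

    The rest is the calculus behind these computations. A vector field is smooth
    if its coordinates in one chart are (smooth_vfP), or if its inner products
    with smooth fields are (smooth_vf_inner). Derivatives of functions in
    directions tangent to Y or to its boundary are computed on segments in a
    straightening chart (line_in, line_in_bdry); comparing two charts in this way
    shows that the tangent spaces and the boundary do not depend on the chart,
    and that identities valid on the boundary may be differentiated along it
    (tangent_boundary_dirder). *)

(** * Differentiable functions on R^7 *)

Section Neighbourhoods.
Context {T : topologicalType}.

Lemma open_near (A : set T) x :
  open A -> A x -> \forall y \near x, A y.
Proof. by move=> oA Ax; exact: open_nbhs_nbhs. Qed.

Lemma near_openP (P : T -> Prop) x :
  (\forall y \near x, P y) -> exists V, [/\ open V, V x & forall y, V y -> P y].
Proof.
by rewrite -nbhs_nearE nbhsE => -[V [oV Vx] VP]; exists V.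
Qed.

Lemma near_nearby (P : T -> Prop) (x : T) :
  (\forall y \near x, P y) -> \forall y \near x, \forall z \near y, P z.
Proof.
move=> /near_openP[U [oU Ux UP]]; apply: filterS (open_near oU Ux) => y Uy.
by apply: filterS (open_near oU Uy).
Qed.

Lemma near_and (P Q : T -> Prop) (x : T) :
  (\forall y \near x, P y) -> (\forall y \near x, Q y) ->
  \forall y \near x, P y /\ Q y.
Proof. by move=> hP hQ; apply: filterS2 hP hQ. Qed.

End Neighbourhoods.

Section Differentiability.
Context {R : realType} {V W : normedModType R}.

(** The difference g - f vanishes near x, hence is differentiable at x with zero
    differential. *)
Lemma near_eq_differentiable (f g : V -> W) x :
  (\forall y \near x, f y = g y) -> differentiable f x -> differentiable g x.
Proof.
move=> fg df.
suff dh : differentiable (g - f) x.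
  by rewrite -(subrK f g); exact: differentiableD.
have : \forall y \near (0 : V), f (y + x) = g (y + x).
  move: fg; rewrite (near_shift 0) subr0.
  by apply: filterS => y.
move=> fg0.
have zc : continuous (\0 : V -> W) by move=> y; exact: cvg_cst.
have h0 : (g - f) \o shift x
    = cst ((g - f) x) + (\0 : {linear V -> W}) +o_ (0 : V) id.
  apply/eqaddoP => e e0; near=> y.
  have hx : (g - f) x = 0.
    by rewrite -[LHS]/(g x - f x) (nbhs_singleton fg) subrr.
  have -> : ((g - f) \o shift x - (cst ((g - f) x) + \0)) y = 0.
    rewrite -[LHS]/(g (y + x) - f (y + x) - ((g - f) x + 0)) hx addr0 subr0.
    by rewrite (near fg0 y)// subrr.
  by rewrite normr0 mulr_ge0// ltW.
apply/diff_locallyP.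
by rewrite (diff_unique (df := \0) zc h0).
Unshelve. all: by end_near. Qed.

Lemma derive_comp {U : normedModType R} (f : W -> U) (G : V -> W) x v :
  differentiable G x -> differentiable f (G x) ->
  'D_v (f \o G) x = 'D_('D_v G x) f (G x).
Proof.
move=> dG df; rewrite !deriveE//; last exact: differentiable_comp.
by rewrite diff_comp.
Qed.

End Differentiability.

Section SmoothCalculus.
Context {R : realType}.
Implicit Types (A B : set 'rV[R]_7) (f g : 'rV[R]_7 -> R).

Lemma Ck_sub k A B f : A `<=` B -> Ck k B f -> Ck k A f.
Proof.
move=> AB; elim: k f => [|k IH] f /=; first by move=> h x /AB; exact: h.
by move=> [h1 h2]; split => [x /AB|i]; [exact: h1|exact/IH/h2].
Qed.

Lemma Ck_eq k A f g : open A -> (forall x, A x -> f x = g x) ->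
  Ck k A f -> Ck k A g.
Proof.
move=> oA; elim: k f g => [|k IH] f g fg /=.
  move=> h x Ax; have fgx : \forall y \near x, f y = g y.
    by apply: filterS (open_near oA Ax) => y; exact: fg.
  rewrite /prop_for /continuous_at -(fg _ Ax).
  by apply: cvg_trans (h x Ax); exact: near_eq_cvg fgx.
move=> [h1 h2]; split => [x Ax|i].
  apply: near_eq_differentiable (h1 x Ax).
  by apply: filterS (open_near oA Ax) => y; exact: fg.
apply: IH (h2 i) => x Ax; apply: near_eq_derive.
by apply: filterS (open_near oA Ax) => y; exact: fg.
Qed.

Lemma CkS k A f : Ck k.+1 A f -> Ck k A f.
Proof.
elim: k f => [|k IH] f [h1 h2].
  by move=> x Ax; exact: differentiable_continuous (h1 x Ax).
by split => // i; apply: IH; exact: h2.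
Qed.

Lemma Ck_cst k A (c : R) : Ck k A (fun=> c).
Proof.
elim: k c => [|k IH] c /=; first by move=> x _; exact: cst_continuous.
split => [x _|i]; first exact: differentiable_cst.
rewrite (_ : (fun x => _) = fun=> (0 : R)); first exact: IH.
by apply/funext => x; exact: derive_cst.
Qed.

Lemma CkD k A f g : open A -> Ck k A f -> Ck k A g ->
  Ck k A (fun x => f x + g x).
Proof.
move=> oA; elim: k f g => [|k IH] f g /=.
  by move=> h1 h2 x Ax; exact: continuousD (h1 x Ax) (h2 x Ax).
move=> [h1 h2] [h3 h4]; split => [x Ax|i].
  by apply: differentiableD; [exact: h1|exact: h3].
apply: Ck_eq (IH _ _ (h2 i) (h4 i)) => // x Ax.
by rewrite -deriveD//; apply: diff_derivable; do 1?[exact: h1|exact: h3].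
Qed.

Lemma CkM k A f g : open A -> Ck k A f -> Ck k A g ->
  Ck k A (fun x => f x * g x).
Proof.
move=> oA; elim: k f g => [|k IH] f g; first move=> h1 h2 x Ax.
  exact: continuousM (h1 x Ax) (h2 x Ax).
move=> hf hg; have [h1 h2] := hf; have [h3 h4] := hg; split => [x Ax|i].
  by apply: differentiableM; [exact: h1|exact: h3].
apply: Ck_eq (CkD oA (IH _ _ (CkS hf) (h4 i)) (IH _ _ (CkS hg) (h2 i))) => //.
move=> x Ax; rewrite -deriveM//.
  by apply: diff_derivable; exact: h1.
by apply: diff_derivable; exact: h3.
Qed.

(** The derivative of f^-1 is a polynomial in f^-1 and the derivative of f, so that
    each step of the induction gains one order; the square root below is treated
    in the same way. *)
Lemma CkV k A f : open A -> (forall x, A x -> f x != 0) -> Ck k A f ->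
  Ck k A (fun x => (f x)^-1).
Proof.
move=> oA f0; elim: k => [|k IH].
  by move=> h x Ax; exact: continuousV (f0 x Ax) (h x Ax).
move=> hf; have [h1 h2] := hf; split => [x Ax|i].
  by apply: differentiableV; [exact: h1|exact: f0].
have hV := IH (CkS hf).
apply: Ck_eq (CkM oA (Ck_cst k A (-1)) (CkM oA (CkM oA hV hV) (h2 i))) => //.
move=> x Ax; rewrite deriveV ?f0//; last exact/diff_derivable/h1.
by rewrite mulN1r -[_ *: _]/(_ * _) mulNr -exprVn expr2.
Qed.

Lemma Ck_sqrt k A f : open A -> (forall x, A x -> 0 < f x) -> Ck k A f ->
  Ck k A (fun x => Num.sqrt (f x)).
Proof.
move=> oA f0.
have ds x : A x -> differentiable (@Num.sqrt R) (f x).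
  move=> Ax; apply/derivable1_diffP.
  by have [] := is_derive1_sqrt (f0 _ Ax).
elim: k => [|k IH].
  by move=> h x Ax; apply: continuous_comp; [exact: h|exact: sqrt_continuous].
move=> hf; have [h1 h2] := hf; split => [x Ax|i].
  by apply: differentiable_comp; [exact: h1|exact: ds].
have hV : Ck k A (fun x => (Num.sqrt (f x))^-1).
  apply: CkV => //; last exact: IH (CkS hf).
  by move=> x Ax; rewrite gt_eqF// sqrtr_gt0 f0.
apply: Ck_eq (CkM oA (Ck_cst k A (2^-1)) (CkM oA hV (h2 i))) => //.
move=> x Ax.
rewrite [RHS](derive_comp (f := @Num.sqrt R) _ (h1 x Ax) (ds x Ax)).
set y := 'D_(delta_mx 0 i) f x.
rewrite (deriveE _ (ds x Ax)) -[in RHS](mulr1 y) -[y * 1]/(y *: 1) linearZ /=.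
rewrite -(deriveE _ (ds x Ax))
  (@derive_val _ _ _ _ _ _ _ (is_derive1_sqrt (f0 _ Ax))).
by rewrite -[_ *: _]/(_ * _) /=; field; rewrite gt_eqF ?sqrtr_gt0 ?f0.
Qed.

Lemma differentiable_row m (V : normedModType R) (G : V -> 'rV[R]_m.+1) x :
  (forall i, differentiable (fun y => G y 0 i) x) -> differentiable G x.
Proof.
move=> h.
have -> : G = \sum_(i < m.+1) (fun y => G y 0 i *: delta_mx 0 i).
  apply/funext => y; rewrite fct_sumE; exact: row_sum_delta.
by apply: differentiable_sum => i; exact: differentiableZl.
Qed.

Lemma continuous_row m (T : topologicalType) (G : T -> 'rV[R]_m.+1) x :
  (forall i, {for x, continuous (fun y => G y 0 i)}) -> {for x, continuous G}.
Proof.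
move=> h.
have -> : G = \sum_(i < m.+1) (fun y => G y 0 i *: delta_mx 0 i).
  by apply/funext => y; rewrite fct_sumE; exact: row_sum_delta.
elim/big_ind : _ => [|f g cf cg|i _]; first exact: cst_continuous.
  exact: continuousD cf cg.
by apply: cvgZr_tmp; exact: h.
Qed.

Lemma derive_row_coord m (V : normedModType R) (G : V -> 'rV[R]_m.+1) x v i :
  differentiable G x -> 'D_v (fun y => G y 0 i) x = ('D_v G x) 0 i.
Proof.
move=> dG; rewrite derive_mx ?mxE//; exact: diff_derivable.
Qed.

Lemma derive_sum_partial f x v : differentiable f x ->
  'D_v f x = \sum_i v 0 i * 'D_(delta_mx 0 i) f x.
Proof.
move=> df; rewrite deriveE// {1}(row_sum_delta v) linear_sum.
by apply: eq_bigr => i _; rewrite linearZ /= deriveE.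
Qed.

Lemma Ck_sum k A (I : Type) (r : seq I) (P : pred I)
    (F : I -> 'rV[R]_7 -> R) : open A ->
  (forall i, P i -> Ck k A (F i)) -> Ck k A (fun x => \sum_(i <- r | P i) F i x).
Proof.
move=> oA h; elim: r => [|i r IH].
  by apply: Ck_eq (Ck_cst k A 0) => // x _; rewrite big_nil.
have [Pi|nPi] := boolP (P i).
  by apply: Ck_eq (CkD oA (h _ Pi) IH) => // x _; rewrite big_cons Pi.
by apply: Ck_eq IH => // x _; rewrite big_cons (negbTE nPi).
Qed.

Lemma Ck_comp k A B f (G : 'rV[R]_7 -> 'rV[R]_7) : open A ->
  (forall x, A x -> B (G x)) -> (forall i, Ck k A (fun x => G x 0 i)) ->
  Ck k B f -> Ck k A (f \o G).
Proof.
move=> oA AB; elim: k f => [|k IH] f hG hf.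
  move=> x Ax; apply: continuous_comp; last exact/hf/AB.
  by apply: continuous_row => i; exact: hG.
have [h1 h2] := hf.
have dG x : A x -> differentiable G x.
  by move=> Ax; apply: differentiable_row => i; apply: (hG i).1.
split => [x Ax|i].
  by apply: differentiable_comp; [exact: dG|exact/h1/AB].
have hk : Ck k A (fun x => \sum_j 'D_(delta_mx 0 i) (fun y => G y 0 j) x *
    (('D_(delta_mx 0 j) f) \o G) x).
  apply: Ck_sum => // j _; apply: CkM => //; first exact: (hG j).2.
  by apply: IH; [move=> l; exact/CkS/hG|exact: h2].
apply: Ck_eq hk => // x Ax.
rewrite (derive_comp _ (dG x Ax) (h1 _ (AB _ Ax))).
rewrite derive_sum_partial; last exact/h1/AB.
by apply: eq_bigr => j _; rewrite derive_row_coord//; exact: dG.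
Qed.

End SmoothCalculus.

(** * Smooth functions on a manifold *)

Section SmoothFunctions.
Context {R : realType} {M : manifold7 R}.
Implicit Types (p q : M) (f g : M -> R) (U : set M) (c : chart R M).

Lemma open_chart_image c U : open U -> open (cmap c @` (U `&` cdom c)).
Proof.
move=> oU; rewrite openE => _ [q [Uq cq] <-].
have ciq : (cmap c @` cdom c) (cmap c q) by exists q.
have U' : \forall y \near cmap c q, U (cinv c y).
  apply: (cinv_continuous ciq); rewrite /= (cmapK cq); exact: open_near.
near=> y.
have [r cr ry] : (cmap c @` cdom c) y.
  by near: y; exact: open_near (@cimg_open _ _ c) ciq.
exists r => //; split => //; rewrite -(cmapK cr) ry.
by near: y.
Unshelve. all: by end_near. Qed.

Lemma chart_imageP c U x : (cmap c @` (U `&` cdom c)) x ->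
  [/\ U (cinv c x), cdom c (cinv c x) & cmap c (cinv c x) = x].
Proof. by move=> [q [Uq cq] <-]; rewrite cmapK. Qed.

Lemma smooth_fun_sub U V f : U `<=` V -> smooth_fun V f -> smooth_fun U f.
Proof.
move=> UV h c ac k; apply: Ck_sub (h c ac k) => _ [q [/UV Vq cq] <-].
by exists q.
Qed.

Lemma smooth_near_near p f :
  smooth_near p f -> \forall q \near p, smooth_near q f.
Proof.
by move=> [U [oU Up h]]; apply: filterS (open_near oU Up) => q Uq; exists U.
Qed.

(** Smoothness is tested in the charts, so the closure properties of smooth_near
    are inherited from those of Ck; P is the domain of the operation, such as
    the nonzero numbers for the inverse. *)
Lemma smooth_near_op1 (P : R -> Prop) (op : R -> R) p f :
  (forall k A F, open A -> (forall x, A x -> P (F x)) -> Ck k A F ->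
     Ck k A (fun x => op (F x))) ->
  (\forall q \near p, P (f q)) ->
  smooth_near p f -> smooth_near p (fun q => op (f q)).
Proof.
move=> hop /near_openP[V [oV Vp VP]] [U [oU Up hU]].
exists (U `&` V); split => //; first exact: openI.
move=> c ac k; apply: (hop k _ (f \o cinv c)); first exact/open_chart_image/openI.
  by move=> x /chart_imageP[[_ /VP]].
exact: (smooth_fun_sub (@subIsetl _ U V) hU).
Qed.

Lemma smooth_near_op2 (op : R -> R -> R) p f g :
  (forall k A F G, open A -> Ck k A F -> Ck k A G ->
     Ck k A (fun x => op (F x) (G x))) ->
  smooth_near p f -> smooth_near p g -> smooth_near p (fun q => op (f q) (g q)).
Proof.
move=> hop [U [oU Up hU]] [V [oV Vp hV]].
exists (U `&` V); split => //; first exact: openI.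
move=> c ac k; apply: (hop k _ (f \o cinv c) (g \o cinv c)).
- exact/open_chart_image/openI.
- exact: (smooth_fun_sub (@subIsetl _ U V) hU).
- exact: (smooth_fun_sub (@subIsetr _ U V) hV).
Qed.

Lemma smooth_near_eq p f g : (\forall q \near p, f q = g q) ->
  smooth_near p f -> smooth_near p g.
Proof.
move=> /near_openP[V [oV Vp VP]] [U [oU Up hU]].
exists (U `&` V); split => //; first exact: openI.
move=> c ac k; apply: Ck_eq (smooth_fun_sub (@subIsetl _ U V) hU ac k).
  exact/open_chart_image/openI.
by move=> x /chart_imageP[[_ /VP]].
Qed.

Lemma smooth_near_cst p (a : R) : smooth_near p (fun=> a).
Proof.
exists setT; split => //; first exact: openT.
by move=> c ac k; exact: Ck_cst.
Qed.

Lemma smooth_nearD p f g :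
  smooth_near p f -> smooth_near p g -> smooth_near p (fun q => f q + g q).
Proof. apply: smooth_near_op2 => k A F G; exact: CkD. Qed.

Lemma smooth_nearM p f g :
  smooth_near p f -> smooth_near p g -> smooth_near p (fun q => f q * g q).
Proof. apply: smooth_near_op2 => k A F G; exact: CkM. Qed.

Lemma smooth_nearN p f : smooth_near p f -> smooth_near p (fun q => - f q).
Proof.
move=> h; apply: smooth_near_eq (smooth_nearM (smooth_near_cst p (-1)) h).
by apply: nearW => q; rewrite mulN1r.
Qed.

Lemma smooth_near_sum p (I : Type) (r : seq I) (P : pred I) (F : I -> M -> R) :
  (forall i, P i -> smooth_near p (F i)) ->
  smooth_near p (fun q => \sum_(i <- r | P i) F i q).
Proof.
move=> h; elim: r => [|i r IH].
  by apply: smooth_near_eq (smooth_near_cst p 0); apply: nearW => q; rewrite big_nil.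
have [Pi|nPi] := boolP (P i).
  apply: smooth_near_eq (smooth_nearD (h _ Pi) IH).
  by apply: nearW => q; rewrite big_cons Pi.
by apply: smooth_near_eq IH; apply: nearW => q; rewrite big_cons (negbTE nPi).
Qed.

Lemma smooth_near_prod p (I : Type) (r : seq I) (P : pred I) (F : I -> M -> R) :
  (forall i, P i -> smooth_near p (F i)) ->
  smooth_near p (fun q => \prod_(i <- r | P i) F i q).
Proof.
move=> h; elim: r => [|i r IH].
  by apply: smooth_near_eq (smooth_near_cst p 1); apply: nearW => q; rewrite big_nil.
have [Pi|nPi] := boolP (P i).
  apply: smooth_near_eq (smooth_nearM (h _ Pi) IH).
  by apply: nearW => q; rewrite big_cons Pi.
by apply: smooth_near_eq IH; apply: nearW => q; rewrite big_cons (negbTE nPi).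
Qed.

Lemma smooth_near_det p m (A : M -> 'M[R]_m) :
  (forall i j, smooth_near p (fun q => A q i j)) ->
  smooth_near p (fun q => \det (A q)).
Proof.
move=> h; rewrite /determinant; apply: smooth_near_sum => s _.
by apply: smooth_nearM; [exact: smooth_near_cst|exact: smooth_near_prod].
Qed.

Lemma smooth_near_continuous p f : smooth_near p f -> {for p, continuous f}.
Proof.
move=> [U [oU Up hU]].
have [c [ac cp]] := atlas_cover p.
have hc : {for cmap c p, continuous (f \o cinv c)}.
  by apply: (hU c ac 0%N); exists p.
rewrite /prop_for /continuous_at.
have : (f \o cinv c) \o cmap c @ p --> f p.
  have -> : f p = ((f \o cinv c) \o cmap c) p by rewrite /= (cmapK cp).
  exact: continuous_comp (cmap_continuous cp) hc.
apply: cvg_trans; apply: near_eq_cvg.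
by apply: filterS (open_near (@cdom_open _ _ c) cp) => q cq; rewrite /= cmapK.
Qed.

Lemma smooth_near_gt0 p f : smooth_near p f -> 0 < f p -> \forall q \near p, 0 < f q.
Proof.
move=> /smooth_near_continuous cf fp.
exact: (cf _ (open_near (@open_gt _ 0) fp)).
Qed.

Lemma smooth_near_neq0 p f : smooth_near p f -> f p != 0 ->
  \forall q \near p, f q != 0.
Proof.
move=> /smooth_near_continuous cf fp.
exact: (cf _ (open_near (@open_neq _ 0) fp)).
Qed.

Lemma smooth_nearV p f :
  smooth_near p f -> f p != 0 -> smooth_near p (fun q => (f q)^-1).
Proof.
move=> hf fp.
apply: (smooth_near_op1 (P := fun y => y != 0) _ (smooth_near_neq0 hf fp) hf).
by move=> k A F; exact: CkV.
Qed.

Lemma smooth_near_sqrt p f :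
  smooth_near p f -> 0 < f p -> smooth_near p (fun q => Num.sqrt (f q)).
Proof.
move=> hf fp.
apply: (smooth_near_op1 (P := fun y => 0 < y) _ (smooth_near_gt0 hf fp) hf).
by move=> k A F; exact: Ck_sqrt.
Qed.

Lemma smooth_near_chart c (i : 'I_7) p :
  atlas M c -> cdom c p -> smooth_near p (fun q => cmap c q 0 i).
Proof.
move=> ac cp; exists (cdom c); split => //; first exact: cdom_open.
by move=> c' ac'; rewrite setIC; exact: atlas_smooth.
Qed.

Lemma smooth_near_differentiable c p f : atlas M c -> cdom c p ->
  smooth_near p f -> differentiable (f \o cinv c) (cmap c p).
Proof.
by move=> ac cp [U [oU Up hU]]; apply: (hU c ac 1%N).1; exists p.
Qed.

Definition transition c c' : 'rV[R]_7 -> 'rV[R]_7 := cmap c' \o cinv c.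

Lemma transition_coord c c' (i : 'I_7) k : atlas M c -> atlas M c' ->
  Ck k (cmap c @` (cdom c' `&` cdom c)) (fun x => transition c c' x 0 i).
Proof. by move=> ac ac'; rewrite setIC; exact: atlas_smooth. Qed.

Lemma transition_differentiable c c' p : atlas M c -> atlas M c' ->
  cdom c p -> cdom c' p -> differentiable (transition c c') (cmap c p).
Proof.
move=> ac ac' cp cp'; apply: differentiable_row => i.
by apply: (transition_coord i 1%N ac ac').1; exists p.
Qed.

Lemma near_chart c p (P : M -> Prop) : cdom c p ->
  (\forall q \near p, P q) -> \forall x \near cmap c p,
    [/\ P (cinv c x), cdom c (cinv c x) & cmap c (cinv c x) = x].
Proof.
move=> cp /near_openP[V [oV Vp VP]].
have oA := open_chart_image (c := c) oV.
have Ap : (cmap c @` (V `&` cdom c)) (cmap c p) by exists p.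
by apply: filterS (open_near oA Ap) => x /chart_imageP[/VP].
Qed.

Lemma derive_transition {W : normedModType R} c c' p (f : M -> W) u :
  atlas M c -> atlas M c' ->
  cdom c p -> cdom c' p -> differentiable (f \o cinv c') (cmap c' p) ->
  'D_u (f \o cinv c) (cmap c p)
  = 'D_('D_u (transition c c') (cmap c p)) (f \o cinv c') (cmap c' p).
Proof.
move=> ac ac' cp cp' df.
have tE : transition c c' (cmap c p) = cmap c' p.
  by rewrite /transition /= cmapK.
rewrite -[in RHS]tE -derive_comp; first last.
- by rewrite tE.
- exact: transition_differentiable.
apply: near_eq_derive.
have := near_chart cp (open_near (@cdom_open _ _ c') cp').
by apply: filterS => x [cx' _ _]; rewrite /transition /= cmapK.
Qed.

Definition partial c (i : 'I_7) f q : R :=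
  'D_(delta_mx 0 i) (f \o cinv c) (cmap c q).

(** In another chart c' the partial derivative is composed with the transition
    from c' to c. *)
Lemma smooth_near_partial c i p f : atlas M c -> cdom c p ->
  smooth_near p f -> smooth_near p (partial c i f).
Proof.
move=> ac cp [U [oU Up hU]]; exists (U `&` cdom c); split => //.
  by apply: openI => //; exact: cdom_open.
move=> c' ac' k.
have hf : Ck k (cmap c @` (U `&` cdom c))
    (fun x => 'D_(delta_mx 0 i) (f \o cinv c) x) := (hU c ac k.+1).2 i.
apply: (Ck_comp (G := transition c' c) _ _ _ hf).
- by apply/open_chart_image/openI => //; exact: cdom_open.
- by move=> x /chart_imageP[[Ux cx] cx' _]; exists (cinv c' x).
- move=> j; apply: Ck_sub (transition_coord j k ac' ac).
  by move=> _ [q [[Uq cq] cq'] <-]; exists q.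
Qed.

End SmoothFunctions.

(** * Tangent vectors and vector fields *)

Section VectorFields.
Context {R : realType} {M : manifold7 R}.
Implicit Types (p q : M) (f g : M -> R) (c : chart R M) (u v : 'rV[R]_7).
Implicit Types X Y Z : M -> 'rV[R]_7.

Lemma chart_atP p : atlas M (chart_at p) /\ cdom (chart_at p) p.
Proof. exact: projT2 (cid (atlas_cover p)). Qed.

(** The isomorphism from T_qM to R^7 given by the coordinates c, and its
    inverse. Only their algebraic properties matter below, and they are locked
    to prevent the expansion of the limits that define them. *)
Definition tcoord c q v : 'rV[R]_7 :=
  locked ('D_v (transition (chart_at q) c) (cmap (chart_at q) q)).
Definition tvec c q u : 'rV[R]_7 :=
  locked ('D_u (transition c (chart_at q)) (cmap c q)).

Lemma derive_chart_id c q u : cdom c q ->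
  'D_u (cmap c \o cinv c) (cmap c q) = u.
Proof.
move=> cq; rewrite -[RHS](derive_id (cmap c q) u); apply: near_eq_derive.
by apply: filterS (near_chart cq (open_near (@cdom_open _ _ c) cq)) => x [].
Qed.

Lemma tcoordK c q v : atlas M c -> cdom c q -> tvec c q (tcoord c q v) = v.
Proof.
move=> ac cq; have [a0 c0] := chart_atP q.
rewrite /tcoord /tvec -!lock -[RHS](derive_chart_id v c0).
rewrite [RHS](derive_transition _ a0 ac c0 cq)//.
exact: transition_differentiable.
Qed.

Lemma tvecK c q u : atlas M c -> cdom c q -> tcoord c q (tvec c q u) = u.
Proof.
move=> ac cq; have [a0 c0] := chart_atP q.
rewrite /tcoord /tvec -!lock -[RHS](derive_chart_id u cq).
rewrite [RHS](derive_transition _ ac a0 cq c0)//.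
exact: transition_differentiable.
Qed.

Lemma tcoord0 c q : tcoord c q 0 = 0.
Proof. by rewrite /tcoord -lock derive0. Qed.

Lemma tcoord_linear c q a u v : atlas M c -> cdom c q ->
  tcoord c q (a *: u + v) = a *: tcoord c q u + tcoord c q v.
Proof.
move=> ac cq; have [a0 c0] := chart_atP q.
have d := transition_differentiable a0 ac c0 cq.
by rewrite /tcoord -!lock !(deriveE _ d) linearP.
Qed.

Lemma tcoordZ c q a u : atlas M c -> cdom c q ->
  tcoord c q (a *: u) = a *: tcoord c q u.
Proof.
move=> ac cq; have := tcoord_linear a u 0 ac cq.
by rewrite tcoord0 !addr0.
Qed.

Lemma tvec0 c q : tvec c q 0 = 0.
Proof. by rewrite /tvec -lock derive0. Qed.

Lemma tvec_sum c q v : atlas M c -> cdom c q ->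
  tvec c q v = \sum_i v 0 i *: tvec c q (delta_mx 0 i).
Proof.
move=> ac cq; have [a0 c0] := chart_atP q.
have d := transition_differentiable ac a0 cq c0.
rewrite /tvec -lock (deriveE _ d) {1}(row_sum_delta v) linear_sum.
by apply: eq_bigr => i _; rewrite linearZ /= -lock (deriveE _ d).
Qed.

Lemma dirder_coord c q v i : atlas M c -> cdom c q ->
  dirder q v (fun r => cmap c r 0 i) = tcoord c q v 0 i.
Proof.
move=> ac cq; have [a0 c0] := chart_atP q.
by rewrite /tcoord -lock -derive_row_coord//; exact: transition_differentiable.
Qed.

Lemma dirder_chart c q v f : atlas M c -> cdom c q -> smooth_near q f ->
  dirder q v f = 'D_(tcoord c q v) (f \o cinv c) (cmap c q).
Proof.
move=> ac cq sf; have [a0 c0] := chart_atP q.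
rewrite /dirder /tcoord -lock (derive_transition _ a0 ac c0 cq)//.
exact: smooth_near_differentiable.
Qed.

Lemma dirder_partial c q v f : atlas M c -> cdom c q -> smooth_near q f ->
  dirder q v f = \sum_i tcoord c q v 0 i * partial c i f q.
Proof.
move=> ac cq sf; rewrite (dirder_chart _ ac cq)// derive_sum_partial//.
exact: smooth_near_differentiable.
Qed.

Lemma dirder_linear q a u v f : smooth_near q f ->
  dirder q (a *: u + v) f = a * dirder q u f + dirder q v f.
Proof.
move=> sf; have [a0 c0] := chart_atP q.
by rewrite /dirder !(deriveE _ (smooth_near_differentiable a0 c0 sf)) linearP.
Qed.

(** X f is the sum of the products of the coordinates of X in any one chart with
    the partial derivatives of f, which are smooth. *)
Lemma smooth_vfP c p X : atlas M c -> cdom c p ->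
  smooth_vf p X <-> forall i, smooth_near p (fun q => tcoord c q (X q) 0 i).
Proof.
move=> ac cp; have near_c := open_near (@cdom_open _ _ c) cp; split.
  move=> sX i; apply: smooth_near_eq (sX _ (smooth_near_chart i ac cp)).
  by apply: filterS near_c => q cq; rewrite dirder_coord.
move=> h f sf.
apply: (@smooth_near_eq _ _ p
  (fun q => \sum_i tcoord c q (X q) 0 i * partial c i f q)).
  apply: filterS2 near_c (smooth_near_near sf) => q cq sfq.
  by rewrite (dirder_partial _ ac cq).
apply: smooth_near_sum => i _; apply: smooth_nearM => //.
exact: smooth_near_partial.
Qed.

Lemma smooth_vf_near p X : smooth_vf p X -> \forall q \near p, smooth_vf q X.
Proof.
have [c [ac cp]] := atlas_cover p.
move=> /(smooth_vfP _ ac cp) h.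
have near_c := open_near (@cdom_open _ _ c) cp.
have : \forall q \near p, forall i, smooth_near q (fun q => tcoord c q (X q) 0 i).
  by apply: filter_forall => i; exact: smooth_near_near.
apply: filterS2 near_c => q cq hq; exact/(smooth_vfP _ ac cq).
Qed.

Lemma smooth_vf_eq p X Y : (\forall q \near p, X q = Y q) ->
  smooth_vf p X -> smooth_vf p Y.
Proof.
move=> XY sX f sf; apply: smooth_near_eq (sX f sf).
by apply: filterS XY => q ->.
Qed.

Lemma smooth_vfZD p f X Y : smooth_near p f -> smooth_vf p X -> smooth_vf p Y ->
  smooth_vf p (fun q => f q *: X q + Y q).
Proof.
move=> sf sX sY g sg.
apply: smooth_near_eq (smooth_nearD (smooth_nearM sf (sX g sg)) (sY g sg)).
by apply: filterS (smooth_near_near sg) => q sgq; rewrite dirder_linear.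
Qed.

Lemma smooth_vf0 p : smooth_vf p (fun=> 0).
Proof.
move=> f sf; apply: smooth_near_eq (smooth_near_cst p 0).
by apply: nearW => q; rewrite /dirder derive0.
Qed.

Lemma smooth_vfZ p f X : smooth_near p f -> smooth_vf p X ->
  smooth_vf p (fun q => f q *: X q).
Proof.
move=> sf sX; have h := smooth_vfZD sf sX (@smooth_vf0 p).
apply: (@smooth_vf_eq p _ _ _ h).
by apply: nearW => q; rewrite addr0.
Qed.

Lemma smooth_vfD p X Y : smooth_vf p X -> smooth_vf p Y ->
  smooth_vf p (fun q => X q + Y q).
Proof.
move=> sX sY; have h := smooth_vfZD (smooth_near_cst p 1) sX sY.
apply: (@smooth_vf_eq p _ _ _ h).
by apply: nearW => q; rewrite scale1r.
Qed.

Lemma smooth_vfB p X Y : smooth_vf p X -> smooth_vf p Y ->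
  smooth_vf p (fun q => X q - Y q).
Proof.
move=> sX sY; have h := smooth_vfZD (smooth_near_cst p (-1)) sY sX.
apply: (@smooth_vf_eq p _ _ _ h).
by apply: nearW => q; rewrite scaleN1r addrC.
Qed.

Lemma smooth_vf_tvec c p (z : M -> 'rV[R]_7) : atlas M c -> cdom c p ->
  (forall i, smooth_near p (fun q => z q 0 i)) ->
  smooth_vf p (fun q => tvec c q (z q)).
Proof.
move=> ac cp sz; apply/(smooth_vfP _ ac cp) => i.
apply: smooth_near_eq (sz i).
by apply: filterS (open_near (@cdom_open _ _ c) cp) => q cq; rewrite tvecK.
Qed.

Lemma smooth_vf_extension p v : exists2 Z, smooth_vf p Z & Z p = v.
Proof.
have [c [ac cp]] := atlas_cover p.
exists (fun q => tvec c q (tcoord c p v)); last exact: tcoordK.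
by apply: smooth_vf_tvec => // i; exact: smooth_near_cst.
Qed.

End VectorFields.

Section Metric.
Context {R : realType} {M : manifold7 R} (g : M -> 'M[R]_7).
Hypothesis hg : riemannian_metric g.
Implicit Types (p q : M) (u v w : 'rV[R]_7).

Lemma innerC p u v : inner g p u v = inner g p v u.
Proof. by have [] := hg. Qed.

Lemma inner_linear p a u v w :
  inner g p (a *: u + v) w = a * inner g p u w + inner g p v w.
Proof. by rewrite /inner !mulmxDl -!scalemxAl !mxE. Qed.

Lemma inner_gt0 p u : u != 0 -> 0 < inner g p u u.
Proof. by have [_ + _] := hg; exact. Qed.

(** The coordinates of Z are recovered by Cramer's rule from its products with a
    coordinate frame. *)
Lemma smooth_vf_inner p (Z : M -> 'rV[R]_7) :
  (forall T, smooth_vf p T -> smooth_near p (fun q => inner g q (Z q) (T q))) ->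
  smooth_vf p Z.
Proof.
move=> hZ; have [c [ac cp]] := atlas_cover p.
have near_c := open_near (@cdom_open _ _ c) cp.
pose e i q := tvec c q (delta_mx 0 i).
have se i : smooth_vf p (e i).
  by apply: smooth_vf_tvec => // j; exact: smooth_near_cst.
pose G q : 'M[R]_7 := \matrix_(i, j) inner g q (e i q) (e j q).
have sG i j : smooth_near p (fun q => G q i j).
  have [_ _ sm] := hg; apply: smooth_near_eq (sm p _ _ (se i) (se j)).
  by apply: nearW => q; rewrite mxE.
have eE q u j : cdom c q -> (u *m G q) 0 j = inner g q (tvec c q u) (e j q).
  move=> cq; rewrite (tvec_sum _ ac cq) mxE /inner !mulmx_suml summxE.
  apply: eq_bigr => i _; rewrite mxE /inner -!scalemxAl [in RHS]mxE.
  by [].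
have Gunit q : cdom c q -> G q \in unitmx.
  move=> cq; rewrite -row_free_unit -kermx_eq0.
  apply/rowV0P => u /sub_kermxP uG.
  have : inner g q (tvec c q u) (tvec c q u) = 0.
    rewrite {2}(tvec_sum _ ac cq) innerC /inner !mulmx_suml summxE big1// => i _.
    rewrite -!scalemxAl mxE -[X in _ * X]/(inner g q (e i q) (tvec c q u)).
    by rewrite innerC -(eE _ _ _ cq) uG mxE mulr0.
  have [t0 _|t0 /eqP] := eqVneq (tvec c q u) 0; last by rewrite gt_eqF ?inner_gt0.
  by have := tvecK u ac cq; rewrite t0 => <-; exact: tcoord0.
pose h q : 'rV[R]_7 := \row_j inner g q (Z q) (e j q).
have sh j : smooth_near p (fun q => h q 0 j).
  by apply: smooth_near_eq (hZ _ (se j)); apply: nearW => q; rewrite mxE.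
have det0 : \det (G p) != 0 by rewrite -unitfE -unitmxE; exact: Gunit.
apply/(smooth_vfP _ ac cp) => i.
apply: (@smooth_near_eq _ _ p
  (fun q => \sum_j h q 0 j * ((\det (G q))^-1 * cofactor (G q) i j))).
  apply: filterS near_c => q cq.
  have -> : tcoord c q (Z q) = h q *m invmx (G q).
    apply: (can_inj (mulmxK (Gunit q cq))); rewrite mulmxKV ?Gunit//.
    by apply/rowP => j; rewrite (eE _ _ _ cq) tcoordK// [RHS]mxE.
  rewrite [RHS]mxE; apply: eq_bigr => j _.
  by rewrite /invmx Gunit// !mxE.
apply: smooth_near_sum => j _; apply: smooth_nearM => //.
apply: smooth_nearM.
  by apply: smooth_nearV det0; exact: smooth_near_det.
apply: smooth_nearM; first exact: smooth_near_cst.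
apply: smooth_near_det => a b; apply: smooth_near_eq (sG _ _).
by apply: nearW => q; rewrite !mxE.
Qed.

End Metric.

(** * The cross product on R^7 *)

Section StandardG2.
Context {R : realType}.
Implicit Types u v w : 'rV[R]_7.

Lemma sum7E (F : 'I_7 -> R) :
  \sum_i F i = F (inord 0) + F (inord 1) + F (inord 2) + F (inord 3)
    + F (inord 4) + F (inord 5) + F (inord 6).
Proof.
rewrite !big_ord_recr big_ord0 /= add0r.
by do 6?congr (_ + _); congr F; apply/val_inj; rewrite /= inordK.
Qed.

Lemma dx3E (i j k : nat) u v w : dx3 i j k u v w =
  let U a := u 0 (inord a) in let V a := v 0 (inord a) in
  let W a := w 0 (inord a) in
  U i * (V j * W k - V k * W j) - U j * (V i * W k - V k * W i)
  + U k * (V i * W j - V j * W i).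
Proof.
rewrite /dx3 (expand_det_row _ ord0) !big_ord_recl big_ord0.
rewrite /cofactor !(expand_det_row _ ord0) !big_ord_recl !big_ord0.
rewrite /cofactor !det_mx11 !mxE /=.
rewrite !(tnth_nth 0) /=.
by rewrite /bump /=; ring.
Qed.

Lemma dot7E u v : (u *m v^T) 0 0 = \sum_i u 0 i * v 0 i.
Proof. by rewrite mxE; apply: eq_bigr => i _; rewrite mxE. Qed.

Definition minor2 u v (a b : nat) : R :=
  u 0 (inord a) * v 0 (inord b) - u 0 (inord b) * v 0 (inord a).

(** The product of imaginary octonions: its k-th component collects the minors
    that multiply the k-th coordinate of w in phi0 u v w. *)
Definition cross0 u v : 'rV[R]_7 :=
  let B := minor2 u v in
  \row_k nth 0 [:: B 1%N 2%N + B 3%N 4%N + B 5%N 6%N;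
                   B 2%N 0%N + B 3%N 5%N - B 4%N 6%N;
                   B 0%N 1%N - B 3%N 6%N - B 4%N 5%N;
                   B 4%N 0%N + B 5%N 1%N - B 6%N 2%N;
                   B 0%N 3%N - B 6%N 1%N - B 5%N 2%N;
                   B 6%N 0%N + B 1%N 3%N - B 2%N 4%N;
                   B 0%N 5%N - B 1%N 4%N - B 2%N 3%N] k.

Lemma cross0E u v w : (cross0 u v *m w^T) 0 0 = phi0 u v w.
Proof.
by rewrite dot7E sum7E !mxE !inordK//= /minor2 /phi0 !dx3E /=; ring.
Qed.

Lemma dot_cross0 u v w : (cross0 u v *m (cross0 u w)^T) 0 0 =
  (u *m u^T) 0 0 * (v *m w^T) 0 0 - (u *m v^T) 0 0 * (u *m w^T) 0 0.
Proof.
by rewrite !dot7E !sum7E !mxE !inordK//= /minor2; ring.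
Qed.

Lemma phi0_cycle u v w : phi0 u v w = phi0 v w u.
Proof. by rewrite /phi0 !dx3E /=; ring. Qed.

Lemma phi0_swap u v w : phi0 u v w = - phi0 u w v.
Proof. by rewrite /phi0 !dx3E /=; ring. Qed.

Lemma phi0_linear a u u' v w :
  phi0 (a *: u + u') v w = a * phi0 u v w + phi0 u' v w.
Proof. by rewrite /phi0 !dx3E /= !mxE; ring. Qed.

End StandardG2.

(** * The cross product on the tangent spaces *)

Section PointwiseG2.
Context {R : realType} {M : g2_manifold R}.
Implicit Types (p : M) (u v w a b : 'rV[R]_7).

Let hg : riemannian_metric (@metric R M) := metric_riemannian M.

Lemma ipC p u v : ip p u v = ip p v u.
Proof. exact: innerC hg _ _ _. Qed.

Lemma ipDl p u v w : ip p (u + v) w = ip p u w + ip p v w.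
Proof. by rewrite /ip -{1}[u]scale1r inner_linear mul1r. Qed.

Lemma ipZl p k u w : ip p (k *: u) w = k * ip p u w.
Proof. by rewrite /ip /inner -!scalemxAl mxE. Qed.

Lemma ipNl p u w : ip p (- u) w = - ip p u w.
Proof. by rewrite -scaleN1r ipZl mulN1r. Qed.

Lemma ipBl p u v w : ip p (u - v) w = ip p u w - ip p v w.
Proof. by rewrite ipDl ipNl. Qed.

Lemma ip0l p w : ip p 0 w = 0.
Proof. by rewrite -(scale0r 0) ipZl mul0r. Qed.

Lemma ipDr p u v w : ip p w (u + v) = ip p w u + ip p w v.
Proof. by rewrite !(ipC p w) ipDl. Qed.

Lemma ipZr p k u w : ip p w (k *: u) = k * ip p w u.
Proof. by rewrite !(ipC p w) ipZl. Qed.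

Lemma ipNr p u w : ip p w (- u) = - ip p w u.
Proof. by rewrite !(ipC p w) ipNl. Qed.

Lemma ip_gt0 p u : u != 0 -> 0 < ip p u u.
Proof. exact: inner_gt0. Qed.

Lemma ip_eq0 p u : ip p u u = 0 -> u = 0.
Proof. by apply: contra_eq => /(ip_gt0 p) /gt_eqF ->. Qed.

Lemma ip_inj p u v : (forall w, ip p u w = ip p v w) -> u = v.
Proof. by move=> h; apply/subr0_eq/(@ip_eq0 p); rewrite ipBl h subrr. Qed.

(** In such a frame every identity between the metric, the 3-form and the vector
    product reduces to a polynomial identity on R^7. *)
Lemma g2_frame p : exists F : 'M[R]_7, [/\ F \in unitmx,
  forall u v, ip p (u *m F) (v *m F) = (u *m v^T) 0 0,
  forall u v w, phi p (u *m F) (v *m F) (w *m F) = phi0 u v w &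
  forall u v, cross p (u *m F) (v *m F) = cross0 u v *m F].
Proof.
have [F [Fu Fg Fphi]] := phi_nondegenerate p; exists F; split => // u v.
have zP : (forall w, ip p (cross0 u v *m F) w = phi p (u *m F) (v *m F) w).
  by move=> w; rewrite -(mulmxKV Fu w) Fphi /ip Fg cross0E.
have := @xgetPex _ 0 [set z | forall w, ip p z w = phi p (u *m F) (v *m F) w].
move=> /(_ (ex_intro _ _ zP)) cP.
by apply: (@ip_inj p) => w; rewrite zP; exact: cP.
Qed.

Ltac in_frame p :=
  have [F [Fu Fg Fphi Fc]] := g2_frame p;
  have K : forall x : 'rV[R]_7, x = x *m invmx F *m F
    by move=> x; rewrite mulmxKV.

Lemma ip_cross p u v w : ip p (cross p u v) w = phi p u v w.
Proof.
by in_frame p; rewrite (K u) (K v) (K w) Fc Fg Fphi cross0E.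
Qed.

(** |u x v|^2 = |u|^2 |v|^2 - <u, v>^2, polarised. *)
Lemma ip_cross_cross p u v w : ip p (cross p u v) (cross p u w) =
  ip p u u * ip p v w - ip p u v * ip p u w.
Proof.
by in_frame p; rewrite (K u) (K v) (K w) !Fc !Fg dot_cross0.
Qed.

Lemma phi_cycle p u v w : phi p u v w = phi p v w u.
Proof. by in_frame p; rewrite (K u) (K v) (K w) !Fphi phi0_cycle. Qed.

Lemma phi_swap p u v w : phi p u v w = - phi p u w v.
Proof. by in_frame p; rewrite (K u) (K v) (K w) !Fphi phi0_swap. Qed.

Lemma phi_linear p k u u' v w :
  phi p (k *: u + u') v w = k * phi p u v w + phi p u' v w.
Proof.
in_frame p; rewrite (K u) (K u') (K v) (K w) scalemxAl -mulmxDl !Fphi.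
exact: phi0_linear.
Qed.

Lemma phi_swapl p u v w : phi p u v w = - phi p v u w.
Proof. by rewrite phi_cycle phi_swap. Qed.

Lemma phiD1 p u u' v w : phi p (u + u') v w = phi p u v w + phi p u' v w.
Proof. by rewrite -[u]scale1r phi_linear mul1r scale1r. Qed.

Lemma phi01 p v w : phi p 0 v w = 0.
Proof.
by have := phi_linear p 1 0 0 v w; rewrite scale1r addr0 mul1r; lra.
Qed.

Lemma phiZ1 p k u v w : phi p (k *: u) v w = k * phi p u v w.
Proof. by rewrite -[k *: u]addr0 phi_linear phi01 addr0. Qed.

Lemma phiB1 p u u' v w : phi p (u - u') v w = phi p u v w - phi p u' v w.
Proof. by rewrite phiD1 -scaleN1r phiZ1 mulN1r. Qed.

Lemma phiD2 p u u' v w : phi p v (u + u') w = phi p v u w + phi p v u' w.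
Proof. by rewrite !(phi_swapl p v) phiD1 opprD. Qed.

Lemma phiZ2 p k u v w : phi p v (k *: u) w = k * phi p v u w.
Proof. by rewrite !(phi_swapl p v) phiZ1 mulrN. Qed.

Lemma phiB2 p u u' v w : phi p v (u - u') w = phi p v u w - phi p v u' w.
Proof. by rewrite phiD2 -scaleN1r phiZ2 mulN1r. Qed.

Lemma phiD3 p u u' v w : phi p v w (u + u') = phi p v w u + phi p v w u'.
Proof. by rewrite -!(phi_cycle p _ v w) phiD1. Qed.

Lemma phiZ3 p k u v w : phi p v w (k *: u) = k * phi p v w u.
Proof. by rewrite -!(phi_cycle p _ v w) phiZ1. Qed.

Lemma phi_alt23 p u v : phi p v u u = 0.
Proof. have := phi_swap p v u u; lra. Qed.

Lemma phi_alt13 p u v : phi p u v u = 0.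
Proof. by rewrite phi_cycle phi_alt23. Qed.

Lemma cross_perpl p u v : ip p (cross p u v) u = 0.
Proof. by rewrite ip_cross phi_alt13. Qed.

Lemma cross_perpr p u v : ip p (cross p u v) v = 0.
Proof. by rewrite ip_cross phi_alt23. Qed.

Lemma cross_linearr p k l u v w :
  cross p u (k *: v + l *: w) = k *: cross p u v + l *: cross p u w.
Proof.
by apply: (@ip_inj p) => x; rewrite ipDl !ipZl !ip_cross phiD2 !phiZ2.
Qed.

Lemma crossC p u v : cross p u v = - cross p v u.
Proof. by apply: (@ip_inj p) => w; rewrite ipNl !ip_cross phi_swapl. Qed.

(** By ip_cross_cross, n x is an isometry of the orthogonal complement of n; it is
    skew-symmetric, hence a complex structure. *)
Lemma cross_cross p n v : ip p n n = 1 -> ip p n v = 0 ->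
  cross p n (cross p n v) = - v.
Proof.
move=> nn nv; apply: (@ip_inj p) => w.
rewrite ipNl ip_cross phi_swap -ip_cross ip_cross_cross nn nv.
by rewrite ipC; ring.
Qed.

(** Up to sign this is <a x v, a x n>, a combination of <v, n> and <a, n>: the
    product with a vector orthogonal to n maps the complex line of a, for the
    complex structure n x, into its orthogonal complement. *)
Lemma phi_complex_line p n v a : ip p n v = 0 -> ip p n a = 0 ->
  phi p v a (cross p n a) = 0.
Proof.
move=> nv na; rewrite phi_swapl -ip_cross (crossC p n a) ipNr ip_cross_cross.
by rewrite !(ipC p _ n) nv na; ring.
Qed.

End PointwiseG2.

(** * Derivatives along segments in a chart *)

Section CurveDerivative.
Context {R : realType}.

Lemma derive_ge0 {V : normedModType R} (H : V -> R) x u :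
  differentiable H x -> H x = 0 ->
  (\forall t \near (0 : R), 0 < t -> 0 <= H (t *: u + x)) -> 0 <= 'D_u H x.
Proof.
move=> dH Hx0 Hge.
have dvH : (fun h : R => h^-1 *: (H (h *: u + x) - H x)) @ (0 : R)^'+ --> 'D_u H x.
  have h : (fun h : R => h^-1 *: (H (h *: u + x) - H x)) @ (0 : R)^' --> 'D_u H x.
    exact: (@diff_derivable _ _ _ H x u dH).
  apply: cvg_trans h; apply: cvg_app.
  by move=> A [e e0 Ae]; exists e => // y ye y0; apply: Ae => //; exact: lt0r_neq0.
rewrite -(cvg_lim _ dvH)//; apply: limr_ge; first exact: cvgP dvH.
rewrite near_withinE; apply: filterS Hge => t ht t0.
by rewrite Hx0 subr0 mulr_ge0 ?invr_ge0 ?(ltW t0) ?ht.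
Qed.

Context {M : manifold7 R}.
Implicit Types (p q : M) (f : M -> R) (c : chart R M) (u v : 'rV[R]_7).

Definition line c p u (t : R) : M := cinv c (t *: u + cmap c p).

Lemma near_line c p u (P : M -> Prop) : cdom c p -> (\forall q \near p, P q) ->
  \forall t \near (0 : R), [/\ P (line c p u t), cdom c (line c p u t) &
    cmap c (line c p u t) = t *: u + cmap c p].
Proof.
move=> cp /(near_chart cp) Pp.
have ct : (fun t : R => t *: u + cmap c p) @ (0 : R) --> cmap c p.
  rewrite -[X in _ --> X]add0r -(scale0r u).
  by apply: cvgD; [exact: scalel_continuous|exact: cvg_cst].
exact: ct _ Pp.
Qed.

Lemma tcoordN c q v : atlas M c -> cdom c q -> tcoord c q (- v) = - tcoord c q v.
Proof. by move=> ac cq; rewrite -scaleN1r tcoordZ// scaleN1r. Qed.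

Lemma dirderN p v f : smooth_near p f -> dirder p (- v) f = - dirder p v f.
Proof.
move=> sf; have := dirder_linear (-1) v 0 sf.
by rewrite addr0 scaleN1r mulN1r {3}/dirder derive0 addr0.
Qed.

Lemma dirderB p v f g : smooth_near p f -> smooth_near p g ->
  dirder p v (fun q => f q - g q) = dirder p v f - dirder p v g.
Proof.
move=> sf sg; have [a0 c0] := chart_atP p.
by rewrite /dirder -deriveB//; exact/diff_derivable/smooth_near_differentiable.
Qed.

Lemma dirder_ge0 c p v f : atlas M c -> cdom c p -> smooth_near p f -> f p = 0 ->
  (\forall t \near (0 : R), 0 < t -> 0 <= f (line c p (tcoord c p v) t)) ->
  0 <= dirder p v f.
Proof.
move=> ac cp sf fp hf; rewrite (dirder_chart _ ac cp)//.
by apply: derive_ge0 => //=; [exact: smooth_near_differentiable|rewrite cmapK].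
Qed.

Lemma dirder_eq0 c p v f : atlas M c -> cdom c p -> smooth_near p f -> f p = 0 ->
  (\forall t \near (0 : R), 0 < t -> f (line c p (tcoord c p v) t) = 0) ->
  dirder p v f = 0.
Proof.
move=> ac cp sf fp hf; apply/eqP; rewrite eq_le; apply/andP; split; last first.
  by apply: (dirder_ge0 ac cp sf fp); apply: filterS hf => t h /h ->.
rewrite -oppr_ge0.
have -> : - dirder p v f = dirder p v (fun q => - f q).
  have [a0 c0] := chart_atP p.
  rewrite /dirder -deriveN//; exact/diff_derivable/smooth_near_differentiable.
apply: (dirder_ge0 ac cp); [exact: smooth_nearN|by rewrite fp oppr0|].
by apply: filterS hf => t h /h ->; rewrite oppr0.
Qed.

End CurveDerivative.

(** * Submanifolds with boundary *)

Section Boundary.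
Context {R : realType} {M : g2_manifold R} (Y : set M).
Implicit Types (p q : M) (f : M -> R) (c : chart R M) (u v w : 'rV[R]_7).

Lemma dirder_chart_coord c p v i : atlas M c -> cdom c p ->
  dirder p v (chart_coord c i) = tcoord c p v 0 i.
Proof. exact: dirder_coord. Qed.

Lemma smooth_chart_coord c p i : atlas M c -> cdom c p ->
  smooth_near p (chart_coord c i).
Proof. exact: smooth_near_chart. Qed.

Definition straight_chart c : Prop := slice_chart Y c \/ half_slice_chart Y c.

Lemma straight_atlas c : straight_chart c -> atlas M c.
Proof. by case=> -[]. Qed.

Lemma straight_chart0 c p (i : 'I_7) : straight_chart c -> cdom c p -> Y p ->
  (3 <= i)%N -> chart_coord c i p = 0.
Proof.
by move=> [] [ac cY] cp /(cY _ cp); [move=> h|move=> [_ h]]; exact: h.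
Qed.

(** In the chart, Y is given by x_3 = ... = x_6 = 0, together with x_0 >= 0 for a
    half-slice. The last condition is kept for small times if x_0 > 0 at p, or
    if the segment does not decrease x_0. *)
Lemma line_in c p u : straight_chart c -> cdom c p -> Y p ->
  (forall i : 'I_7, (3 <= i)%N -> u 0 i = 0) ->
  slice_chart Y c \/ 0 < chart_coord c ord0 p \/ 0 <= u 0 ord0 ->
  \forall t \near (0 : R), 0 < t -> Y (line c p u t).
Proof.
move=> sc cp Yp u0 side.
have cl := near_line u cp (open_near (@cdom_open _ _ c) cp).
have l0 t (i : 'I_7) : cmap c (line c p u t) = t *: u + cmap c p -> (3 <= i)%N ->
    chart_coord c i (line c p u t) = 0.
  move=> e i3; rewrite /chart_coord e !mxE u0// mulr0 add0r.
  exact: (straight_chart0 sc).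
case: sc => -[ac cY].
  by apply: filterS cl => t [_ ct e] _; apply/(cY _ ct) => i; exact: l0.
have [Y0 _] := (cY _ cp).1 Yp.
case: side => [[_ sY]|side].
  apply: filterS cl => t [_ ct e] _; apply/(sY _ ct) => i; exact: l0.
have pos : \forall t \near (0 : R), 0 < t -> 0 <= t * u 0 ord0 + cmap c p 0 ord0.
  case: side => [x0|u00].
    have ct : {for 0, continuous (fun t : R => t * u 0 ord0 + cmap c p 0 ord0)}.
      apply: continuousD; last exact: cst_continuous.
      by apply: continuousM; [exact: cvg_id|exact: cst_continuous].
    rewrite /prop_for /continuous_at mul0r add0r in ct.
    have x0' : \forall y \near cmap c p 0 ord0, 0 < y.
      exact: open_near (@open_gt _ 0) x0.
    have : \forall t \near (0 : R), 0 < t * u 0 ord0 + cmap c p 0 ord0 := ct _ x0'.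
    by move=> h; apply: (@filterS _ _ _ _ _ _ h) => t /ltW.
  by apply: (@nearW _ (nbhs (0 : R))) => t /ltW t0; rewrite addr_ge0// mulr_ge0.
apply: filterS2 cl pos => t [_ ct e] post t0; apply/(cY _ ct); split.
  by rewrite /chart_coord e !mxE post.
by move=> i; exact: l0.
Qed.

(** One of the segments with velocities v and -v starts inside Y, and a
    one-sided derivative suffices. Applied to the coordinates of another chart,
    this shows that the tangent space does not depend on the chart. *)
Lemma tangent_dirder p v f : Y p -> smooth_near p f -> tangent Y p v ->
  (\forall q \near p, Y q -> f q = 0) -> dirder p v f = 0.
Proof.
move=> Yp sf [c [cp sc v0]] fY.
have ac := straight_atlas sc.
have fp : f p = 0 by exact: (nbhs_singleton fY).
have key w : (forall i : 'I_7, (3 <= i)%N -> tcoord c p w 0 i = 0) ->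
    slice_chart Y c \/ 0 < chart_coord c ord0 p \/ 0 <= tcoord c p w 0 ord0 ->
    dirder p w f = 0.
  move=> w0 side; apply: (dirder_eq0 ac cp sf fp).
  have := near_line (tcoord c p w) cp fY.
  by apply: filterS2 (line_in sc cp Yp w0 side) => t Yt [ft _ _] /Yt /ft.
have v0' (i : 'I_7) : (3 <= i)%N -> tcoord c p v 0 i = 0.
  by move=> i3; rewrite -dirder_chart_coord// v0.
have [v00|v00] := leP 0 (tcoord c p v 0 ord0); first by apply: key; auto.
rewrite -[v]opprK dirderN// key ?oppr0// (tcoordN v ac cp).
  by move=> i i3; rewrite mxE v0' ?oppr0.
by right; right; rewrite mxE oppr_ge0 ltW.
Qed.

Lemma tangentP c p v : straight_chart c -> cdom c p -> Y p ->
  tangent Y p v <-> forall i : 'I_7, (3 <= i)%N -> tcoord c p v 0 i = 0.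
Proof.
move=> sc cp Yp; have ac := straight_atlas sc; split => [tv i i3|h].
  rewrite -dirder_chart_coord//; apply: tangent_dirder tv _ => //.
    exact: smooth_chart_coord.
  apply: filterS (open_near (@cdom_open _ _ c) cp) => q cq Yq.
  exact: (straight_chart0 sc).
by exists c; split => // i i3; rewrite dirder_chart_coord// h.
Qed.

Lemma bdry_sub p : bdry Y p -> Y p.
Proof. by case. Qed.

(** If the first coordinate of c were positive at q, then Y would extend from q in
    both directions along every tangent vector, whereas in a boundary chart at q
    it stays on one side of a hypersurface transverse to it. *)
Lemma bdry_half_slice c q : half_slice_chart Y c -> cdom c q -> bdry Y q ->
  boundary_chart Y q c.
Proof.
move=> hc cq [Yq [c' [hc' cq' c'0]]]; split => //.
have [ac cY] := hc; have [ac' cY'] := hc'.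
have [+ _] := (cY _ cq).1 Yq; rewrite le_eqVlt => /predU1P[<-//|c0].
(* a tangent vector that points inwards in c' *)
pose v := tvec c' q (delta_mx 0 ord0).
have v' : tcoord c' q v = delta_mx 0 ord0 by rewrite tvecK.
have tv : tangent Y q v.
  apply/(tangentP _ (or_intror hc') cq' Yq) => i i3; rewrite v' mxE.
  by rewrite eqxx /=; case: eqP i3 => // ->.
have sf := smooth_chart_coord ord0 ac' cq'.
have key w : (forall i : 'I_7, (3 <= i)%N -> tcoord c q w 0 i = 0) ->
    0 <= dirder q w (chart_coord c' ord0).
  move=> w0; apply: (dirder_ge0 ac cq sf c'0).
  have nc := near_line (tcoord c q w) cq (open_near (@cdom_open _ _ c') cq').
  have := line_in (or_intror hc) cq Yq w0 (or_intror (or_introl c0)).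
  by apply: filterS2 nc => t [ct _ _] Yt /Yt /(cY' _ ct)[].
have tv0 := (tangentP _ (or_intror hc) cq Yq).1 tv.
have := key (- v); rewrite dirderN// dirder_chart_coord// v' mxE !eqxx /=.
have h : forall i : 'I_7, (3 <= i)%N -> tcoord c q (- v) 0 i = 0.
  by move=> i i3; rewrite tcoordN// mxE tv0 ?oppr0.
by move=> /(_ h); lra.
Qed.

Lemma boundary_straight c p : boundary_chart Y p c -> straight_chart c.
Proof. by case=> hc _ _; right. Qed.

Lemma boundary_chart_atlas c p : boundary_chart Y p c -> atlas M c.
Proof. by move=> /boundary_straight/straight_atlas. Qed.

Lemma boundary_chart_dom c p : boundary_chart Y p c -> cdom c p.
Proof. by case. Qed.

Definition boundary_direction u : Prop :=
  u 0 ord0 = 0 /\ forall i : 'I_7, (3 <= i)%N -> u 0 i = 0.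

Lemma line_in_bdry c p u : Y p -> boundary_chart Y p c -> boundary_direction u ->
  \forall t \near (0 : R),
    [/\ Y (line c p u t) & boundary_chart Y (line c p u t) c].
Proof.
move=> Yp bc [u0 ui]; have [[ac cY] cp c0] := bc.
apply: filterS (near_line u cp (open_near (@cdom_open _ _ c) cp)) => t [_ ct e].
have c0t : chart_coord c ord0 (line c p u t) = 0.
  by move: c0; rewrite /chart_coord e !mxE u0 mulr0 add0r.
split; last by split.
apply/(cY _ ct); rewrite c0t; split => // i i3.
rewrite /chart_coord e !mxE ui// mulr0 add0r.
exact: (straight_chart0 (boundary_straight bc)).
Qed.

Lemma bdry_dirder c p v f : Y p -> boundary_chart Y p c ->
  boundary_direction (tcoord c p v) -> smooth_near p f ->
  (\forall q \near p, boundary_chart Y q c -> Y q -> f q = 0) ->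
  dirder p v f = 0.
Proof.
move=> Yp bc bv sf fY; have cp := boundary_chart_dom bc.
apply: (dirder_eq0 (boundary_chart_atlas bc) cp sf).
  exact: (nbhs_singleton fY).
have := near_line (tcoord c p v) cp fY.
apply: filterS2 (line_in_bdry Yp bc bv) => t [Yt bt] [ft _ _] _.
exact: ft.
Qed.

(** Whichever boundary chart shows that v is tangent to the boundary, the segments
    with velocities v and -v in that chart stay in Y, where the first coordinate
    of c is nonnegative; as it vanishes at p, its derivatives along v and -v are
    both nonnegative, hence zero. *)
Lemma tangent_boundary_line c p v : Y p -> boundary_chart Y p c ->
  tangent_boundary Y p v <-> boundary_direction (tcoord c p v).
Proof.
move=> Yp bc; have ac := boundary_chart_atlas bc.
have cp := boundary_chart_dom bc; split=> [[c' [bc' v0 vi]]|[v0 vi]]; last first.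
  exists c; split => //; first by rewrite dirder_chart_coord.
  by move=> i i3; rewrite dirder_chart_coord// vi.
have ac' := boundary_chart_atlas bc'; have cp' := boundary_chart_dom bc'.
have bv : boundary_direction (tcoord c' p v).
  by split=> [|i i3]; rewrite -dirder_chart_coord//; exact: vi.
have bNv : boundary_direction (tcoord c' p (- v)).
  by case: bv => h1 h2; split=> [|i i3]; rewrite tcoordN// mxE ?h1 ?h2 ?oppr0.
have [hc _ c0] := bc; have near_c := open_near (@cdom_open _ _ c) cp.
have ge0 w : boundary_direction (tcoord c' p w) ->
    0 <= dirder p w (chart_coord c ord0).
  move=> bw; apply: (dirder_ge0 ac' cp' (smooth_chart_coord _ ac cp) c0).
  have := near_line (tcoord c' p w) cp' near_c.
  apply: filterS2 (line_in_bdry Yp bc' bw) => t [Yt _] [ct _ _] _.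
  by have [] := (hc.2 _ ct).1 Yt.
split.
  have sf := smooth_chart_coord ord0 ac cp.
  have := ge0 _ bNv; have := ge0 _ bv; rewrite dirderN//.
  by rewrite -dirder_chart_coord//; lra.
move=> i i3; rewrite -dirder_chart_coord//.
apply: (bdry_dirder Yp bc' bv); first exact: smooth_chart_coord.
apply: filterS near_c => q cq _ Yq.
exact: (straight_chart0 (boundary_straight bc)).
Qed.

Lemma boundary_chart_bdry p c : Y p -> boundary_chart Y p c -> bdry Y p.
Proof. by move=> Yp bc; split => //; exists c. Qed.

(** Identities that hold on the boundary can be differentiated along it. *)
Lemma tangent_boundary_dirder p v f : bdry Y p -> tangent_boundary Y p v ->
  smooth_near p f -> (\forall q \near p, bdry Y q -> f q = 0) ->
  dirder p v f = 0.
Proof.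
move=> [Yp [c bc]] /(tangent_boundary_line _ Yp bc) bv sf fY.
apply: (bdry_dirder Yp bc bv sf); apply: filterS fY => q fq bq Yq.
exact/fq/boundary_chart_bdry/bq.
Qed.

Lemma tangent_boundary_dirder_eq p v f g : bdry Y p -> tangent_boundary Y p v ->
  smooth_near p f -> smooth_near p g ->
  (\forall q \near p, bdry Y q -> f q = g q) -> dirder p v f = dirder p v g.
Proof.
move=> bp tv sf sg fg; apply/subr0_eq; rewrite -dirderB//.
apply: tangent_boundary_dirder => //.
  by apply: smooth_nearD => //; exact: smooth_nearN.
by apply: filterS fg => q fgq /fgq ->; rewrite subrr.
Qed.

Lemma tangent_boundary_tangent p v :
  Y p -> tangent_boundary Y p v -> tangent Y p v.
Proof.
move=> Yp [c [bc _ vi]]; exists c; split => //; first exact: boundary_chart_dom bc.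
exact: boundary_straight bc.
Qed.

Lemma tangent_linear p a u v : bdry Y p -> tangent Y p u -> tangent Y p v ->
  tangent Y p (a *: u + v).
Proof.
move=> [Yp [c bc]]; have sc := boundary_straight bc.
have cp := boundary_chart_dom bc.
move=> /(tangentP _ sc cp Yp) hu /(tangentP _ sc cp Yp) hv.
apply/(tangentP _ sc cp Yp) => i i3.
rewrite (tcoord_linear _ _ _ (boundary_chart_atlas bc) cp) !mxE.
by rewrite hu ?hv// mulr0 addr0.
Qed.

Lemma tangent_boundary_linear p a u v : bdry Y p ->
  tangent_boundary Y p u -> tangent_boundary Y p v ->
  tangent_boundary Y p (a *: u + v).
Proof.
move=> [Yp [c bc]]; have cp := boundary_chart_dom bc.
move=> /(tangent_boundary_line _ Yp bc)[hu0 hu].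
move=> /(tangent_boundary_line _ Yp bc)[hv0 hv].
apply/(tangent_boundary_line _ Yp bc).
rewrite (tcoord_linear _ _ _ (boundary_chart_atlas bc) cp).
split=> [|i i3]; rewrite !mxE.
  by rewrite hu0 hv0 mulr0 addr0.
by rewrite hu ?hv// mulr0 addr0.
Qed.

End Boundary.

(** * Linear algebra at a boundary point *)

Section Projection.
Context {R : realType} {M : g2_manifold R}.
Implicit Types (p : M) (u v w a b x : 'rV[R]_7).

Lemma projP p (V : set 'rV[R]_7) u z : V z ->
  (forall a, V a -> ip p (u - z) a = 0) ->
  V (proj p V u) /\ forall a, V a -> ip p (proj p V u) a = ip p u a.
Proof.
move=> Vz hz.
have [Vp hp] : [set z | V z /\ forall a, V a -> ip p (u - z) a = 0] (proj p V u).
  by apply: xgetPex; exists z.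
by split => // a Va; have := hp _ Va; rewrite ipBl; lra.
Qed.

Lemma plane_expansion p (V : {vspace 'rV[R]_7}) a b x : \dim V = 2%N ->
  a \in V -> b \in V -> ip p a a = 1 -> ip p b b = 1 -> ip p a b = 0 ->
  x \in V -> x = ip p x a *: a + ip p x b *: b.
Proof.
move=> dV aV bV aa bb ab xV.
have sum2 (k : 'I_2 -> R) : \sum_(i < 2) k i *: [tuple a; b]`_i
    = k ord0 *: a + k (lift ord0 ord0) *: b.
  by rewrite !big_ord_recl big_ord0 addr0.
have fab : free [tuple a; b].
  apply/freeP => k; rewrite sum2 => e.
  have k0 : k ord0 = 0.
    have := congr1 (fun z => ip p z a) e; rewrite ip0l ipDl !ipZl aa (ipC p b) ab.
    lra.
  have k1 : k (lift ord0 ord0) = 0.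
    have := congr1 (fun z => ip p z b) e; rewrite ip0l ipDl !ipZl bb ab; lra.
  move=> i; case: (unliftP ord0 i) => [j ->|->//].
  by rewrite ord1 k1.
have Vab : V = <<[tuple a; b]>>%VS.
  apply/eqP; rewrite eq_sym eqEdim dV (eqnP fab) leqnn andbT.
  by apply/span_subvP => z; rewrite !inE => /orP[] /eqP ->.
move: xV; rewrite Vab => /coord_span; rewrite sum2.
set k := coord _ _ x; set l := coord _ _ x => xE.
by rewrite xE !ipDl !ipZl aa bb ab (ipC p b) ab; congr (_ *: _ + _ *: _); lra.
Qed.

End Projection.

Lemma boundary_direction_dependence {R : realType} (a b d : 'rV[R]_7) r s t :
  boundary_direction a -> boundary_direction b -> boundary_direction d ->
  r * a 0 (inord 1) + s * b 0 (inord 1) + t * d 0 (inord 1) = 0 ->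
  r * a 0 (inord 2) + s * b 0 (inord 2) + t * d 0 (inord 2) = 0 ->
  r *: a + (s *: b + t *: d) = 0.
Proof.
move=> [a0 a3] [b0 b3] [d0 d3] h1 h2; apply/rowP => i; rewrite !mxE addrA.
have [i3|i3] := leqP 3 i; first by rewrite a3 ?b3 ?d3// !mulr0 !addr0.
have [->|] := eqVneq i ord0; first by rewrite a0 b0 d0 !mulr0 !addr0.
case: i i3 => -[|[|[|//]]] /= hi _ // _.
  by rewrite (_ : Ordinal hi = inord 1)//; apply/val_inj; rewrite /= inordK.
by rewrite (_ : Ordinal hi = inord 2)//; apply/val_inj; rewrite /= inordK.
Qed.

Section BoundaryPoint.
Context {R : realType} {M : g2_manifold R} (Y : set M)
  (nf : M -> 'rV[R]_7) (L : M -> {vspace 'rV[R]_7}).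
Hypotheses (hY : associative_submanifold Y) (hn : inner_unit_normal Y nf)
  (hL : normal_plane_bundle Y L) (hLn : cross_invariant Y nf L).
Variable p : M.
Hypothesis bp : bdry Y p.
Implicit Types (u v w a b x : 'rV[R]_7).

Local Notation n := (nf p).
Let Yp : Y p := bdry_sub bp.

Lemma normal_tangent : tangent Y p n. Proof. by have [] := hn bp. Qed.

Lemma normal_unit : ip p n n = 1. Proof. by have [] := hn bp. Qed.

Lemma normal_perp v : tangent_boundary Y p v -> ip p n v = 0.
Proof. by have [_ _ _ h _] := hn bp; exact: h. Qed.

Lemma tangent_cross u v : tangent Y p u -> tangent Y p v ->
  tangent Y p (cross p u v).
Proof. by have [_ h] := hY; exact: h. Qed.

(** The first coordinate of n in a boundary chart is positive, so that k n + u is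
    tangent to the boundary for some k, and the product with n gives k = 0. *)
Lemma tangent_perp_normal u : tangent Y p u -> ip p n u = 0 ->
  tangent_boundary Y p u.
Proof.
move=> tu nu; have [_ tn n1 nperp [c [bc npos]]] := hn bp.
have ac := boundary_chart_atlas bc; have cp := boundary_chart_dom bc.
have sc := boundary_straight bc.
rewrite (dirder_chart_coord _ _ ac cp) in npos.
set al := tcoord c p n 0 ord0 in npos.
pose k := - tcoord c p u 0 ord0 / al.
have tb : tangent_boundary Y p (k *: n + u).
  apply/(tangent_boundary_line _ Yp bc).
  rewrite (tcoord_linear _ _ _ ac cp); split=> [|i i3]; rewrite !mxE.
    by rewrite -/al /k divfK ?addNr// gt_eqF.
  rewrite ((tangentP _ sc cp Yp).1 tn _ i3) ((tangentP _ sc cp Yp).1 tu _ i3).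
  by rewrite mulr0 addr0.
have := nperp _ tb; rewrite ipDr ipZr n1 nu mulr1 addr0 => k0.
by rewrite k0 scale0r add0r in tb.
Qed.

(** The tangent plane of the boundary has dimension 2: in a boundary chart it
    is identified with R^2, where three vectors satisfy Cramer's relation. *)
Lemma tangent_boundary_perp v w u :
  tangent_boundary Y p v -> tangent_boundary Y p w -> tangent_boundary Y p u ->
  ip p v v = 1 -> ip p w w = 1 -> ip p v w = 0 ->
  ip p u v = 0 -> ip p u w = 0 -> u = 0.
Proof.
move=> tv tw tu vv ww vw uv uw; have [_ [c bc]] := bp.
have ac := boundary_chart_atlas bc; have cp := boundary_chart_dom bc.
pose x a := tcoord c p a 0 (inord 1); pose y a := tcoord c p a 0 (inord 2).
have dep a b d r s t : tangent_boundary Y p a -> tangent_boundary Y p b ->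
    tangent_boundary Y p d -> r * x a + s * x b + t * x d = 0 ->
    r * y a + s * y b + t * y d = 0 -> r *: a + (s *: b + t *: d) = 0.
  move=> /(tangent_boundary_line _ Yp bc) ha /(tangent_boundary_line _ Yp bc) hb.
  move=> /(tangent_boundary_line _ Yp bc) hd hx hy.
  rewrite -[LHS](tcoordK _ ac cp) (tcoord_linear r a _ ac cp).
  rewrite (tcoord_linear s b _ ac cp) (tcoordZ t d ac cp).
  by rewrite (boundary_direction_dependence ha hb hd hx hy) tvec0.
move: x y dep => x y dep.
have ipc a b (d : 'rV[R]_7) r s t z : r *: a + (s *: b + t *: d) = 0 ->
    r * ip p a z + s * ip p b z + t * ip p d z = 0.
  by move=> /(congr1 (fun e => ip p e z)); rewrite ip0l !ipDl !ipZl addrA.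
have wv : ip p w v = 0 by rewrite ipC.
have [D0|D0] := eqVneq (x v * y w - y v * x w) 0.
  have hy : y v *: w + (- y w *: v + 0 *: u) = 0 by apply: dep => //; lra.
  have hx : x v *: w + (- x w *: v + 0 *: u) = 0 by apply: dep => //; lra.
  have yv := ipc _ _ _ _ _ _ w hy; have xv := ipc _ _ _ _ _ _ w hx.
  rewrite ww vw uw in yv xv.
  have v0 : 1 *: v + (0 *: w + 0 *: u) = 0 by apply: dep => //; lra.
  have /eqP := ipc _ _ _ _ _ _ v v0.
  by rewrite vv wv uv mulr1 !mulr0 !addr0 oner_eq0.
have h : (x v * y w - y v * x w) *: u
    + ((y u * x w - x u * y w) *: v + (x u * y v - y u * x v) *: w) = 0.
  by apply: dep => //; ring.
have hv := ipc _ _ _ _ _ _ v h; have hw := ipc _ _ _ _ _ _ w h.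
rewrite uv vv wv in hv; rewrite uw vw ww in hw.
have r0 : y u * x w - x u * y w = 0 by lra.
have s0 : x u * y v - y u * x v = 0 by lra.
by move/eqP: h; rewrite r0 s0 !scale0r !addr0 scaler_eq0 (negbTE D0) => /eqP.
Qed.

Definition adapted_frame v w : Prop :=
  [/\ tangent_boundary Y p v /\ tangent_boundary Y p w,
      ip p v v = 1 /\ ip p w w = 1, ip p v w = 0 & w = cross p n v].

Section Frame.
Variables v w : 'rV[R]_7.
Hypothesis vw : adapted_frame v w.

Lemma tangent_boundary_expansion u : tangent_boundary Y p u ->
  u = ip p u v *: v + ip p u w *: w.
Proof.
have [[tv tw] [v1 w1] v_w _] := vw.
move=> tu; set a := ip p u v; set b := ip p u w.
have tz := tangent_boundary_linear (- a) bp tv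
  (tangent_boundary_linear (- b) bp tw tu).
have z0 : - a *: v + (- b *: w + u) = 0.
  apply: (tangent_boundary_perp tv tw tz) => //; rewrite !ipDl !ipZl.
    by rewrite v1 (ipC p w) v_w -/a; ring.
  by rewrite w1 v_w -/b; ring.
by apply/subr0_eq; rewrite -[RHS]z0 !scaleNr addrA -opprD addrC.
Qed.

Definition tangent_part u := ip p u n *: n + (ip p u v *: v + ip p u w *: w).

Lemma tangent_expansion u : tangent Y p u -> u = tangent_part u.
Proof.
move=> tu; have [[tv tw] _ _ _] := vw.
pose u' := - ip p u n *: n + u.
have tu' : tangent_boundary Y p u'.
  apply: tangent_perp_normal; first exact: tangent_linear normal_tangent tu.
  by rewrite ipDr ipZr normal_unit (ipC p n u); ring.
have uE : u = ip p u n *: n + u' by rewrite /u' scaleNr addNKr.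
rewrite /tangent_part {1}uE (tangent_boundary_expansion tu').
have h z : ip p n z = 0 -> ip p u' z = ip p u z.
  by move=> nz; rewrite /u' ipDl ipZl nz mulr0 add0r.
by rewrite !h ?normal_perp.
Qed.

Lemma tangent_part_tangent u : tangent Y p (tangent_part u).
Proof.
have [[tv tw] _ _ _] := vw.
have tkw := tangent_boundary_linear (ip p u w - 1) bp tw tw.
rewrite scalerBl scale1r subrK in tkw.
have tb := tangent_boundary_linear (ip p u v) bp tv tkw.
exact: tangent_linear normal_tangent (tangent_boundary_tangent Yp tb).
Qed.

Lemma normal_part u : normal_space Y p (u - tangent_part u).
Proof.
have [[tv tw] [v1 w1] v_w _] := vw.
have nv := normal_perp tv; have nw := normal_perp tw.
move=> t /tangent_expansion ->; rewrite /tangent_part.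
rewrite !(ipBl, ipDl, ipDr, ipZl, ipZr, ipNl).
rewrite normal_unit v1 w1 v_w (ipC p w v) v_w.
by rewrite (ipC p v n) (ipC p w n) nv nw; ring.
Qed.

(** The orthogonal complement of the normal space is the tangent space: the
    explicit orthonormal basis n, v, w provides both projections. *)
Lemma proj_normal u :
  exists2 t, tangent Y p t & proj p (normal_space Y p) u = u - t.
Proof.
have [Np hp] : normal_space Y p (proj p (normal_space Y p) u) /\
    forall a, normal_space Y p a ->
    ip p (proj p (normal_space Y p) u) a = ip p u a.
  apply: projP (normal_part u) _ => a Na.
  by rewrite subKr ipC Na//; exact: tangent_part_tangent.
set z := proj _ _ u in Np hp *.
exists (tangent_part (u - z)); first exact: tangent_part_tangent.
have h : u - z = tangent_part (u - z).
  apply/subr0_eq/(@ip_eq0 _ _ p).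
  set s := u - z - _; have Ns : normal_space Y p s by exact: normal_part.
  rewrite {1}/s ipBl (ipBl _ u) -hp// subrr sub0r ipC Ns ?oppr0//.
  exact: tangent_part_tangent.
by rewrite -h subKr.
Qed.

End Frame.

Lemma plane_dim : \dim (L p) = 2%N. Proof. by have [] := hL bp. Qed.

Lemma plane_normal a u : a \in L p -> tangent Y p u -> ip p a u = 0.
Proof. by have [_ h _] := hL bp => /h; exact. Qed.

Lemma plane_cross a : a \in L p -> cross p n a \in L p.
Proof. exact: hLn. Qed.

Lemma plane_frame a : a \in L p -> ip p a a = 1 ->
  [/\ cross p n a \in L p, ip p (cross p n a) (cross p n a) = 1 &
      ip p a (cross p n a) = 0].
Proof.
move=> La aa; split; first exact: plane_cross.
  rewrite ip_cross_cross normal_unit aa (ipC p n) plane_normal//; first by ring.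
  exact: normal_tangent.
by rewrite ipC cross_perpr.
Qed.

Lemma plane_cross_expansion a x : a \in L p -> ip p a a = 1 -> x \in L p ->
  x = ip p x a *: a + ip p x (cross p n a) *: cross p n a.
Proof.
move=> La aa Lx; have [h1 h2 h3] := plane_frame La aa.
exact: plane_expansion plane_dim _ _ _ _ _ _.
Qed.

Lemma plane_unit : exists2 a, a \in L p & ip p a a = 1.
Proof.
have : vpick (L p) != 0 by rewrite vpick0 -dimv_eq0 plane_dim.
set a := vpick _ => a0; have aa := ip_gt0 p a0.
exists ((Num.sqrt (ip p a a))^-1 *: a); first by rewrite memvZ ?memv_pick.
by rewrite ipZl ipZr mulrA -expr2 exprVn sqr_sqrtr ?mulVf ?gt_eqF ?ltW.
Qed.

Lemma proj_plane u : proj p (fun a => a \in L p) u \in L p /\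
  forall a, a \in L p -> ip p (proj p (fun a => a \in L p) u) a = ip p u a.
Proof.
have [e Le ee] := plane_unit; have [Lf ff ef] := plane_frame Le ee.
set f := cross p n e in Lf ff ef.
apply: (@projP _ _ p (fun a => a \in L p) u (ip p u e *: e + ip p u f *: f)).
  by rewrite memvD ?memvZ.
move=> a La; rewrite (plane_cross_expansion Le ee La) -/f.
rewrite ipBl !ipDl !ipDr !ipZl !ipZr ee ff (ipC p f e) ef; ring.
Qed.

(** L is the complex line of any of its unit vectors e, so that v x maps it into
    its orthogonal complement. *)
Lemma phi_plane v a b : ip p n v = 0 -> a \in L p -> b \in L p ->
  phi p v a b = 0.
Proof.
move=> nv La Lb; have [e Le ee] := plane_unit.
have ne : ip p n e = 0.
  by rewrite ipC plane_normal//; exact: normal_tangent.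
have h := phi_complex_line nv ne.
rewrite (plane_cross_expansion Le ee La) (plane_cross_expansion Le ee Lb).
set f := cross p n e in h *.
rewrite !phiD2 !phiD3 !phiZ2 !phiZ3 !phi_alt23 h (phi_swap p v f) h.
ring.
Qed.

(** The tangential part of a derivative does not contribute to D_L, since v x
    preserves the tangent space of Y. *)
Lemma cross_proj_normal v w v' A a : adapted_frame v w -> tangent Y p v' ->
  a \in L p -> ip p (cross p v' (proj p (normal_space Y p) A)) a = phi p v' A a.
Proof.
move=> vw tv' La; have [t tt ->] := proj_normal vw A.
rewrite ip_cross phiB2 -(ip_cross p v' t) (ipC p _ a) plane_normal ?subr0//.
exact: tangent_cross.
Qed.

End BoundaryPoint.

(** * The connection along the boundary *)

Section CovariantDerivative.
Context {R : realType} {M : g2_manifold R} (Y : set M).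
Implicit Types (p q : M) (u v w : 'rV[R]_7) (X Z V W : M -> 'rV[R]_7).

Lemma smooth_ip p X Z : smooth_vf p X -> smooth_vf p Z ->
  smooth_near p (fun q => ip q (X q) (Z q)).
Proof. by have [_ _ h] := metric_riemannian M; exact: h. Qed.

Lemma smooth_cross p X Z : smooth_vf p X -> smooth_vf p Z ->
  smooth_vf p (fun q => cross q (X q) (Z q)).
Proof.
move=> sX sZ; apply: (smooth_vf_inner (metric_riemannian M)) => T sT.
apply: smooth_near_eq (phi_smooth sX sZ sT).
by apply: nearW => q; rewrite -ip_cross.
Qed.

Lemma smooth_nabla p X Z : smooth_vf p X -> smooth_vf p Z ->
  smooth_vf p (fun q => nabla q (X q) Z).
Proof. exact: nabla_smooth (lc_connection (nabla_levi_civita M)) _ _ _. Qed.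

(** Metric compatibility turns the derivatives of X along the boundary into
    derivatives of functions, which depend only on the restriction of X. *)
Lemma nabla_unique p v X Z : bdry Y p -> tangent_boundary Y p v ->
  smooth_vf p X -> smooth_vf p Z -> (\forall q \near p, bdry Y q -> X q = Z q) ->
  nabla p v X = nabla p v Z.
Proof.
move=> bp tv sX sZ XZ; apply: (@ip_inj _ _ p) => w.
have [T sT Tw] := smooth_vf_extension p w.
have lc := lc_metric (nabla_levi_civita M) v.
have eX := lc p _ _ sX sT; have eZ := lc p _ _ sZ sT.
have := tangent_boundary_dirder_eq bp tv (smooth_ip sX sT) (smooth_ip sZ sT).
rewrite /ip eX eZ Tw (nbhs_singleton XZ bp) => h.
apply: (addIr (inner (@metric R M) p (Z p) (nabla p v T))).
apply: h; by apply: filterS XZ => q XZq /XZq ->.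
Qed.

Lemma nabla_alongE p v X psi : bdry Y p -> tangent_boundary Y p v ->
  smooth_vf p X -> (\forall q \near p, bdry Y q -> X q = psi q) ->
  nabla_along Y p v psi = nabla p v X.
Proof.
move=> bp tv sX Xpsi.
have [Z [sZ Zpsi ->]] : [set z | exists Z, [/\ smooth_vf p Z,
    \forall q \near p, bdry Y q -> Z q = psi q & z = nabla p v Z]]
    (nabla_along Y p v psi).
  by apply: xgetPex; exists (nabla p v X), X.
apply: nabla_unique => //.
by apply: filterS2 Zpsi Xpsi => q Zq Xq bq; rewrite Zq ?Xq.
Qed.

(** By absence of torsion the vector is the bracket [V, W]. In a boundary chart its
    coordinates transverse to the boundary are V (W x_i) - W (V x_i), and the
    functions V x_i and W x_i vanish on the boundary. *)
Lemma bracket_tangent p V W : bdry Y p -> smooth_vf p V -> smooth_vf p W ->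
  (\forall q \near p, bdry Y q ->
     tangent_boundary Y q (V q) /\ tangent_boundary Y q (W q)) ->
  tangent_boundary Y p (nabla p (V p) W - nabla p (W p) V).
Proof.
move=> bp sV sW tVW; have [Yp [c bc]] := bp.
have ac := boundary_chart_atlas bc; have cp := boundary_chart_dom bc.
have [tV tW] := nbhs_singleton tVW bp.
have near_c := open_near (@cdom_open _ _ c) cp.
have key (i : 'I_7) : (forall q v, bdry Y q -> cdom c q ->
      tangent_boundary Y q v -> tcoord c q v 0 i = 0) ->
    tcoord c p (nabla p (V p) W - nabla p (W p) V) 0 i = 0.
  move=> hi; have sci := smooth_chart_coord i ac cp.
  rewrite -(dirder_chart_coord _ _ ac cp).
  rewrite (lc_torsion_free (nabla_levi_civita M) sV sW sci).
  have van Z u : smooth_vf p Z ->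
      (\forall q \near p, bdry Y q -> tangent_boundary Y q (Z q)) ->
      tangent_boundary Y p u ->
      dirder p u (fun q => dirder q (Z q) (chart_coord c i)) = 0.
    move=> sZ tZ tu; apply: (tangent_boundary_dirder bp tu (sZ _ sci)).
    apply: filterS2 near_c tZ => q cq tZq bq.
    by rewrite (dirder_chart_coord _ _ ac cq) hi//; exact: tZq.
  rewrite (van W)//; last by apply: filterS tVW => q h /h[].
  by rewrite (van V) ?subrr//; apply: filterS tVW => q h /h[].
have hc : half_slice_chart Y c by have [] := bc.
have bl q v : bdry Y q -> cdom c q -> tangent_boundary Y q v ->
    boundary_direction (tcoord c q v).
  move=> bq cq tv.
  exact/(tangent_boundary_line v (bdry_sub bq) (bdry_half_slice hc cq bq)).
apply/(tangent_boundary_line _ Yp bc); split=> [|i i3]; apply: key.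
  by move=> q v bq cq /(bl q v bq cq)[].
by move=> q v bq cq /(bl q v bq cq)[_]; exact.
Qed.

End CovariantDerivative.

(** * The operator D_L *)

Section BoundaryOperator.
Context {R : realType} {M : g2_manifold R} (Y : set M)
  (n : M -> 'rV[R]_7) (L : M -> {vspace 'rV[R]_7}).
Hypotheses (hY : associative_submanifold Y) (hn : inner_unit_normal Y n)
  (hL : normal_plane_bundle Y L) (hLn : cross_invariant Y n L).
Implicit Types (p q : M) (a b : 'rV[R]_7).
Implicit Types (v w psi chi V W X Z : M -> 'rV[R]_7).

Lemma plane_inj p a b : bdry Y p -> a \in L p -> b \in L p ->
  (forall x, x \in L p -> ip p a x = ip p b x) -> a = b.
Proof.
move=> bp La Lb h; apply/subr0_eq/(@ip_eq0 _ _ p).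
by rewrite ipBl h ?subrr ?memvB.
Qed.

Lemma adapted_frame_tangent p (v w : 'rV[R]_7) : bdry Y p ->
  adapted_frame Y n p v w -> tangent Y p v /\ tangent Y p w.
Proof.
move=> bp [[tv tw] _ _ _]; have Yp := bdry_sub bp.
by split; exact: tangent_boundary_tangent.
Qed.

(** Both projections disappear from the bilinear form <D_L psi, a> on L: the one
    onto L because a is in L, the one onto the normal bundle because the product
    with a tangent vector preserves the tangent space, which is orthogonal to
    a. *)
Lemma DL_frameP p v w psi X : bdry Y p -> adapted_frame Y n p (v p) (w p) ->
  smooth_vf p X -> (\forall q \near p, bdry Y q -> X q = psi q) ->
  DL_frame Y L v w psi p \in L p /\
  forall a, a \in L p -> ip p (DL_frame Y L v w psi p) a =
    phi p (v p) (nabla p (w p) X) a - phi p (w p) (nabla p (v p) X) a.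
Proof.
move=> bp vw sX Xpsi; have [tv tw] := adapted_frame_tangent bp vw.
have [[bv bw] _ _ _] := vw.
rewrite /DL_frame; set u := (X in proj _ _ X).
have [Lu hu] := proj_plane hn hL hLn bp u.
split=> // a La; rewrite hu// /u ipBl /nabla_perp.
rewrite (nabla_alongE bp bw sX Xpsi) (nabla_alongE bp bv sX Xpsi).
by rewrite !(cross_proj_normal hY hn hL bp _ vw _ La).
Qed.

(** Two oriented frames differ by a rotation, so that the expression
    v x nabla_w - w x nabla_v, alternating in (v, w), takes the same value. *)
Lemma DL_frame_independent p v1 w1 v2 w2 psi : bdry Y p ->
  adapted_frame Y n p (v1 p) (w1 p) -> adapted_frame Y n p (v2 p) (w2 p) ->
  smooth_along (bdry Y) p psi ->
  DL_frame Y L v1 w1 psi p = DL_frame Y L v2 w2 psi p.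
Proof.
move=> bp f1 f2 [X [sX Xpsi]].
have [L1 h1] := DL_frameP bp f1 sX Xpsi; have [L2 h2] := DL_frameP bp f2 sX Xpsi.
apply: (plane_inj bp L1 L2) => a La.
apply: etrans (h1 _ La) _; apply: etrans _ (esym (h2 _ La)).
move=> {L1 L2 h1 h2}.
have [[tv1 _] [vv1 _] _ w1E] := f1; have [[tv2 _] [vv2 _] _ w2E] := f2.
have v2E := tangent_boundary_expansion bp f1 tv2.
set r := ip p (v2 p) (v1 p) in v2E; set s := ip p (v2 p) (w1 p) in v2E.
have w2E' : w2 p = r *: w1 p + (- s) *: v1 p.
  rewrite w2E v2E cross_linearr -w1E scaleNr -scalerN; congr (_ + _ *: _).
  by rewrite w1E (cross_cross (normal_unit hn bp) (normal_perp hn bp tv1)).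
have rs : r * r + s * s = 1.
  have [_ [v11 w11] vw1 _] := f1.
  rewrite -vv2 v2E !(ipDl, ipDr, ipZl, ipZr) v11 w11 vw1 (ipC p (w1 p)) vw1.
  by ring.
have lin (x y : 'rV[R]_7) k l :
    nabla p (k *: x + l *: y) X = k *: nabla p x X + l *: nabla p y X.
  have lc := lc_connection (nabla_levi_civita M).
  have n0 : nabla p 0 X = 0.
    have := nabla_linear_l lc 1 0 0 sX; rewrite !scale1r addr0.
    by move=> /(congr1 (fun z => z - nabla p 0 X)); rewrite addrK subrr.
  have nZ : nabla p (l *: y) X = l *: nabla p y X.
    by have := nabla_linear_l lc l y 0 sX; rewrite n0 !addr0.
  by rewrite nabla_linear_l// nZ.
rewrite w2E' v2E !lin; move: (nabla p (v1 p) X) (nabla p (w1 p) X) => A B.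
rewrite !(phiD1, phiD2, phiZ1, phiZ2).
set P1 := phi p (v1 p) A a; set P2 := phi p (v1 p) B a.
set P3 := phi p (w1 p) A a; set P4 := phi p (w1 p) B a.
transitivity ((r * r + s * s) * (P2 - P3)); last by ring.
by rewrite rs mul1r.
Qed.

(** Differentiate phi(V, X, Z) = 0 and phi(W, X, Z) = 0
    along W and V; as phi is parallel, the asymmetry of the form is
    phi([V, W], X, Z), which vanishes because [V, W] is tangent to the
    boundary. *)
Lemma DL_form_symmetric p V W X Z : bdry Y p ->
  smooth_vf p V -> smooth_vf p W -> smooth_vf p X -> smooth_vf p Z ->
  (\forall q \near p, bdry Y q -> adapted_frame Y n q (V q) (W q)) ->
  (\forall q \near p, bdry Y q -> X q \in L q) ->
  (\forall q \near p, bdry Y q -> Z q \in L q) ->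
  phi p (V p) (nabla p (W p) X) (Z p) - phi p (W p) (nabla p (V p) X) (Z p) =
  phi p (V p) (nabla p (W p) Z) (X p) - phi p (W p) (nabla p (V p) Z) (X p).
Proof.
move=> bp sV sW sX sZ fVW LX LZ.
have [[tV tW] _ _ _] := nbhs_singleton fVW bp.
have van T (u : 'rV[R]_7) : smooth_vf p T -> tangent_boundary Y p u ->
    (\forall q \near p, bdry Y q -> tangent_boundary Y q (T q)) ->
    phi p (nabla p u T) (X p) (Z p) + phi p (T p) (nabla p u X) (Z p)
      + phi p (T p) (X p) (nabla p u Z) = 0.
  move=> sT tu tT; rewrite -(phi_parallel u sT sX sZ).
  apply: (tangent_boundary_dirder bp tu (phi_smooth sT sX sZ)).
  have tTX := near_and tT (near_and LX LZ).
  apply: filterS tTX => q [hT [hX hZ]] bq.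
  apply: (phi_plane hn hL hLn bq); [|exact: hX|exact: hZ].
  exact/(normal_perp hn bq)/hT.
have tVW : \forall q \near p, bdry Y q ->
    tangent_boundary Y q (V q) /\ tangent_boundary Y q (W q).
  by apply: filterS fVW => q h /h[].
have tV' : \forall q \near p, bdry Y q -> tangent_boundary Y q (V q).
  by apply: filterS tVW => q h /h[].
have tW' : \forall q \near p, bdry Y q -> tangent_boundary Y q (W q).
  by apply: filterS tVW => q h /h[].
have e1 := van V (W p) sV tW tV'; have e2 := van W (V p) sW tV tW'.
have tb := bracket_tangent bp sV sW tVW.
have := phi_plane hn hL hLn bp (normal_perp hn bp tb) (nbhs_singleton LX bp)
  (nbhs_singleton LZ bp).
rewrite phiB1 (phi_swap p (V p) _ (X p)) (phi_swap p (W p) _ (X p)).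
by move: e1 e2; lra.
Qed.

Lemma smooth_along_vf (S : set M) p X : smooth_vf p X -> smooth_along S p X.
Proof. by move=> sX; exists X; split => //; apply: nearW. Qed.

Lemma oriented_frame_adapted U v w q : oriented_frame Y n U v w -> U q ->
  bdry Y q -> adapted_frame Y n q (v q) (w q).
Proof. by move=> [_ h] Uq bq; have [_ h1 h2 h3 h4] := h q Uq bq; split. Qed.

(** Near each boundary point, a coordinate field tangent to the boundary,
    normalised, starts an oriented frame. *)
Lemma oriented_frame_exists p : bdry Y p ->
  exists U v w, oriented_frame Y n U v w /\ U p.
Proof.
move=> bp; have [Yp [c bc]] := bp.
have ac := boundary_chart_atlas bc; have cp := boundary_chart_dom bc.
have hc : half_slice_chart Y c by have [] := bc.
pose d1 : 'rV[R]_7 := delta_mx 0 (inord 1).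
have bd1 k : boundary_direction (k *: d1).
  split=> [|i i3]; rewrite !mxE.
    case: (ord0 =P inord 1) => [/(congr1 val)|_]; first by rewrite /= inordK.
    by rewrite andbF mulr0.
  case: (i =P inord 1) i3 => [->|_ _]; first by rewrite inordK.
  by rewrite andbF mulr0.
pose e q := tvec c q d1.
pose v q := (Num.sqrt (ip q (e q) (e q)))^-1 *: e q.
pose w q := cross q (n q) (v q).
have e0 q : cdom c q -> 0 < ip q (e q) (e q).
  move=> cq; apply: ip_gt0; apply/eqP => eq0.
  have := tvecK d1 ac cq; rewrite -/(e q) eq0 tcoord0 => /rowP/(_ (inord 1)).
  by rewrite !mxE !eqxx => /esym/eqP; rewrite oner_eq0.
exists (cdom c), v, w; split => //; split; first exact: cdom_open.
move=> q cq bq; have bcq := bdry_half_slice hc cq bq.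
have Yq := bdry_sub bq.
have se : smooth_vf q e.
  by apply: smooth_vf_tvec => // i; exact: smooth_near_cst.
have sv : smooth_vf q v.
  have sq := e0 q cq; apply: smooth_vfZ => //.
  apply: smooth_nearV; last by rewrite gt_eqF// sqrtr_gt0.
  exact: smooth_near_sqrt (smooth_ip se se) sq.
have tv : tangent_boundary Y q (v q).
  apply/(tangent_boundary_line _ Yq bcq).
  by rewrite (tcoordZ _ _ ac cq) (tvecK _ ac cq).
have nv := normal_perp hn bq tv.
have nn := normal_unit hn bq.
have vv : ip q (v q) (v q) = 1.
  rewrite ipZl ipZr mulrA -expr2 exprVn sqr_sqrtr ?(ltW (e0 q cq))//.
  by rewrite mulVf// gt_eqF// e0.
split => //.
- split; first exact: smooth_along_vf.
  have [[N [sN Nn]] _ _ _ _] := hn bq.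
  exists (fun r => cross r (N r) (v r)); split; first exact: smooth_cross.
  by apply: filterS Nn => r Nr br; rewrite Nr.
- split=> //; apply: (tangent_perp_normal hn bq).
    apply: (tangent_cross hY bq (normal_tangent hn bq)).
    exact: tangent_boundary_tangent.
  by rewrite ipC cross_perpl.
- by split => //; rewrite ip_cross_cross nn vv nv; ring.
- by rewrite ipC cross_perpr.
Qed.

(** Smooth extensions, near a boundary point, of an oriented frame (V, W) and of
    an orthonormal frame (E, n x E) of L. *)
Definition smooth_frames p V W E F : Prop :=
  [/\ smooth_vf p V /\ smooth_vf p W, smooth_vf p E /\ smooth_vf p F &
   \forall q \near p, bdry Y q -> [/\ adapted_frame Y n q (V q) (W q),
     E q \in L q, ip q (E q) (E q) = 1 & F q = cross q (n q) (E q)]].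

Lemma smooth_frames_exist p : bdry Y p -> exists V W E F, smooth_frames p V W E F.
Proof.
move=> bp; have [U [v [w [fvw Up]]]] := oriented_frame_exists bp.
have [oU h] := fvw; have [[[V [sV Vv]] [W [sW Ww]]] _ _ _ _] := h p Up bp.
have [[N [sN Nn]] _ _ _ _] := hn bp.
have [dL _ [s1 [s2 [ss1 ss2 Ls]]]] := hL bp.
have s10 : s1 p != 0.
  apply/eqP => s10; have := dL; rewrite (nbhs_singleton Ls bp) s10.
  have : (<<[:: 0%R; s2 p]>> <= <[s2 p]>)%VS.
    apply/span_subvP => z; rewrite !inE => /orP[] /eqP ->.
      exact: mem0v.
    exact: memv_line.
  by move=> /dimvS dl d2; move: dl; rewrite d2 dim_vline; case: (_ != _).
have s1pos := ip_gt0 p s10.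
pose E q := (Num.sqrt (ip q (s1 q) (s1 q)))^-1 *: s1 q.
have ssq := smooth_ip ss1 ss1.
have sE : smooth_vf p E.
  apply: smooth_vfZ => //; apply: smooth_nearV; last by rewrite gt_eqF// sqrtr_gt0.
  exact: smooth_near_sqrt.
exists V, W, E, (fun q => cross q (N q) (E q)).
split; [by split|by split; [exact: sE|exact: smooth_cross sN sE]|].
have near_U := open_near oU Up.
have pos := smooth_near_gt0 ssq s1pos.
have H := near_and (near_and Vv Ww)
  (near_and (near_and Nn Ls) (near_and near_U pos)).
apply: filterS H => q [[hV hW] [[hN hLs] [Uq posq]]] bq; split.
- by rewrite hV// hW//; exact: oriented_frame_adapted fvw Uq bq.
- by rewrite hLs// memvZ// memv_span// inE eqxx.
- rewrite ipZl ipZr mulrA -expr2 exprVn sqr_sqrtr ?(ltW posq)//.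
  by rewrite mulVf// gt_eqF.
- by rewrite hN.
Qed.

(** The field K such that <D_L E, a> = <K, a> for all a in L. *)
Definition DL_field V W E q : 'rV[R]_7 :=
  cross q (V q) (nabla q (W q) E) - cross q (W q) (nabla q (V q) E).

Lemma smooth_DL_field p V W E : smooth_vf p V -> smooth_vf p W ->
  smooth_vf p E -> smooth_vf p (DL_field V W E).
Proof.
move=> sV sW sE; exact: smooth_vfB (smooth_cross sV (smooth_nabla sW sE))
  (smooth_cross sW (smooth_nabla sV sE)).
Qed.

Definition local_section p psi : Prop :=
  smooth_along (bdry Y) p psi /\ \forall q \near p, bdry Y q -> psi q \in L q.

Lemma smooth_section_local psi p : smooth_section Y L psi -> bdry Y p ->
  local_section p psi.
Proof.
move=> h bp; split; first by have [] := h p bp.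
by apply: nearW => q bq; have [] := h q bq.
Qed.

Lemma local_section_extension p psi : local_section p psi ->
  exists X, [/\ smooth_vf p X, \forall q \near p, bdry Y q -> X q = psi q &
    \forall q \near p, bdry Y q -> X q \in L q].
Proof.
move=> [[X [sX Xpsi]] Lpsi]; exists X; split => //.
by apply: filterS2 Xpsi Lpsi => q h1 h2 bq; rewrite h1// h2.
Qed.

(** By symmetry <D_L psi, E> = <psi, D_L E> = <psi, K>, which involves no
    derivative of psi: this is why D_L has order 0. *)
Lemma DL_frame_value p V W E F v w psi : bdry Y p -> smooth_frames p V W E F ->
  adapted_frame Y n p (v p) (w p) -> local_section p psi ->
  DL_frame Y L v w psi p = ip p (psi p) (DL_field V W E p) *: E p
    + ip p (psi p) (DL_field V W F p) *: F p.
Proof.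
move=> bp [[sV sW] [sE sF] fr] fvw lpsi.
have [X [sX Xpsi LX]] := local_section_extension lpsi.
have [fVW LE EE FE] := nbhs_singleton fr bp.
rewrite (DL_frame_independent bp fvw fVW lpsi.1).
have [LD hD] := DL_frameP bp fVW sX Xpsi.
have [LF _ _] := plane_frame hn hL hLn bp LE EE.
rewrite [LHS](plane_cross_expansion hn hL hLn bp LE EE LD) -FE.
rewrite -FE in LF.
have fr' : \forall q \near p, bdry Y q -> adapted_frame Y n q (V q) (W q).
  by apply: filterS fr => q h /h[].
have key T : smooth_vf p T -> (\forall q \near p, bdry Y q -> T q \in L q) ->
    ip p (DL_frame Y L V W psi p) (T p) = ip p (psi p) (DL_field V W T p).
  move=> sT LT; rewrite hD; last exact: (nbhs_singleton LT bp).
  rewrite (DL_form_symmetric bp sV sW sX sT fr' LX LT) ipC ipBl !ip_cross.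
  by rewrite (nbhs_singleton Xpsi bp).
rewrite (key E)//; last by apply: filterS fr => q h /h[].
rewrite (key F)//; apply: filterS fr => q h bq.
have [_ LEq EEq ->] := h bq; exact: (plane_cross hLn bq LEq).
Qed.

Lemma smooth_frames_near p V W E F : smooth_frames p V W E F ->
  \forall q \near p, smooth_frames q V W E F.
Proof.
move=> [[sV sW] [sE sF] fr].
have H := near_and (near_and (smooth_vf_near sV) (smooth_vf_near sW))
  (near_and (near_and (smooth_vf_near sE) (smooth_vf_near sF)) (near_nearby fr)).
by apply: filterS H => q [[? ?] [[? ?] ?]]; split.
Qed.

Lemma local_section_near p psi : local_section p psi ->
  \forall q \near p, local_section q psi.
Proof.
move=> [[X [sX Xpsi]] Lpsi].
have H := near_and (smooth_vf_near sX)
  (near_and (near_nearby Xpsi) (near_nearby Lpsi)).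
by apply: filterS H => q [sXq [Xq Lq]]; split => //; exists X.
Qed.

Lemma local_section_value p a : bdry Y p -> a \in L p ->
  exists2 psi, local_section p psi & psi p = a.
Proof.
move=> bp La; have [V [W [E [F [_ [sE sF] fr]]]]] := smooth_frames_exist bp.
have [_ LE EE FE] := nbhs_singleton fr bp.
pose X q := ip p a (E p) *: E q + ip p a (F p) *: F q.
exists X; last first.
  by rewrite /X FE -(plane_cross_expansion hn hL hLn bp LE EE La).
split.
  apply: smooth_along_vf.
  by apply: smooth_vfD; apply: smooth_vfZ => //; exact: smooth_near_cst.
apply: filterS fr => q h bq; have [_ LEq EEq FEq] := h bq.
by rewrite memvD// memvZ// FEq; exact: (plane_cross hLn bq LEq).
Qed.

Lemma DL_symmetric p v w psi chi : bdry Y p ->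
  adapted_frame Y n p (v p) (w p) -> local_section p psi -> local_section p chi ->
  ip p (DL_frame Y L v w psi p) (chi p) = ip p (psi p) (DL_frame Y L v w chi p).
Proof.
move=> bp fvw lpsi lchi.
have [V [W [E [F fr]]]] := smooth_frames_exist bp.
have [[sV sW] _ frn] := fr.
have [X [sX Xpsi LX]] := local_section_extension lpsi.
have [Z [sZ Zchi LZ]] := local_section_extension lchi.
have [fVW _ _ _] := nbhs_singleton frn bp.
have e1 := DL_frame_independent bp fvw fVW lpsi.1.
have e2 := DL_frame_independent bp fvw fVW lchi.1.
have [_ h1] := DL_frameP bp fVW sX Xpsi; have [_ h2] := DL_frameP bp fVW sZ Zchi.
have Lp := nbhs_singleton lpsi.2 bp; have Lc := nbhs_singleton lchi.2 bp.
apply: etrans (congr1 (fun z => ip p z (chi p)) e1) _.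
apply: etrans _ (esym (congr1 (fun z => ip p (psi p) z) e2)).
apply: etrans (h1 _ Lc) _; apply: etrans _ (ipC _ _ _).
apply: etrans _ (esym (h2 _ Lp)).
have ep := nbhs_singleton Xpsi bp; have ec := nbhs_singleton Zchi bp.
have fr' : \forall q \near p, bdry Y q -> adapted_frame Y n q (V q) (W q).
  by apply: filterS frn => q h /h[].
rewrite -ep -ec; exact: DL_form_symmetric bp sV sW sX sZ fr' LX LZ.
Qed.

Definition DL_matrix_at p (A : 'M[R]_7) : Prop :=
  forall psi v w, local_section p psi -> adapted_frame Y n p (v p) (w p) ->
    DL_frame Y L v w psi p = psi p *m A.

Lemma DL_matrix_exists p : bdry Y p -> exists A, DL_matrix_at p A.
Proof.
move=> bp; have [V [W [E [F fr]]]] := smooth_frames_exist bp.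
pose m (k e : 'rV[R]_7) := metric p *m k^T *m e.
exists (m (DL_field V W E p) (E p) + m (DL_field V W F p) (F p)).
move=> psi v w lpsi fvw; rewrite (DL_frame_value bp fr fvw lpsi) mulmxDr.
have mE a k e : a *m m k e = ip p a k *: e.
  rewrite /m !mulmxA [a *m _ *m _]mx11_scalar mul_scalar_mx.
  by congr (_ *: _).
by rewrite !mE.
Qed.

(** The matrices A q are chosen independently of each other, but on L they are all
    determined by D_L; near p, they act on L by the formula given by smooth
    frames around p, which is smooth in q. *)
Lemma DL_matrix_bundle (A : M -> 'M[R]_7) :
  (forall p, bdry Y p -> DL_matrix_at p (A p)) -> bundle_endomorphism Y L A.
Proof.
move=> hA p bp; split=> [a La|psi spsi Lpsi].
  have [psi lpsi <-] := local_section_value bp La.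
  have [U [v [w [fvw Up]]]] := oriented_frame_exists bp.
  have f := oriented_frame_adapted fvw Up bp.
  rewrite -(hA _ bp _ _ _ lpsi f).
  have [X [sX Xpsi _]] := local_section_extension lpsi.
  by have [] := DL_frameP bp f sX Xpsi.
have lpsi : local_section p psi by [].
have [V [W [E [F fr]]]] := smooth_frames_exist bp.
have [[sV sW] [sE sF] frn] := fr; have [X [sX Xpsi]] := spsi.
exists (fun q => ip q (X q) (DL_field V W E q) *: E q
                 + ip q (X q) (DL_field V W F q) *: F q); split.
  have sKE := smooth_ip sX (smooth_DL_field sV sW sE).
  have sKF := smooth_ip sX (smooth_DL_field sV sW sF).
  exact: smooth_vfD (smooth_vfZ sKE sE) (smooth_vfZ sKF sF).
have H := near_and (near_and (smooth_frames_near fr) (local_section_near lpsi))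
  (near_and frn Xpsi).
apply: filterS H => q [[frq lq] [hq Xq]] bq.
have [f _ _ _] := hq bq.
by rewrite -(hA q bq _ _ _ lq f) (DL_frame_value bq frq f lq) Xq.
Qed.

Lemma DLE psi p : bdry Y p -> local_section p psi ->
  exists v w, adapted_frame Y n p (v p) (w p) /\
    DL Y n L psi p = DL_frame Y L v w psi p.
Proof.
move=> bp lpsi; have [U0 [v0 [w0 [f0 U0p]]]] := oriented_frame_exists bp.
have [U [v [w [f Up e]]]] : [set z | exists U (v w : M -> 'rV[R]_7),
    [/\ oriented_frame Y n U v w, U p & z = DL_frame Y L v w psi p]]
    (DL Y n L psi p).
  by apply: xgetPex; exists (DL_frame Y L v0 w0 psi p), U0, v0, w0.
by exists v, w; split => //; exact: oriented_frame_adapted f Up bp.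
Qed.

End BoundaryOperator.

Theorem proposition1p4 (R : realType) (M : g2_manifold R) (Y : set M)
    (n : M -> 'rV[R]_7) (L : M -> {vspace 'rV[R]_7})
    (hY : associative_submanifold Y) (hn : inner_unit_normal Y n)
    (hL : normal_plane_bundle Y L) (hLn : cross_invariant Y n L) :
  [/\ (* independence of the oriented frame *)
      forall U1 v1 w1 U2 v2 w2 psi,
        oriented_frame Y n U1 v1 w1 -> oriented_frame Y n U2 v2 w2 ->
        smooth_section Y L psi ->
        forall p, bdry Y p -> U1 p -> U2 p ->
          DL_frame Y L v1 w1 psi p = DL_frame Y L v2 w2 psi p,
      (* D_L is an operator on the sections of L *)
      forall psi, smooth_section Y L psi -> smooth_section Y L (DL Y n L psi),
      (* of order 0 *)
      exists A, bundle_endomorphism Y L A /\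
        forall psi, smooth_section Y L psi ->
        forall p, bdry Y p -> DL Y n L psi p = psi p *m A p &
      (* and symmetric *)
      forall psi chi, smooth_section Y L psi -> smooth_section Y L chi ->
        forall p, bdry Y p ->
          ip p (DL Y n L psi p) (chi p) = ip p (psi p) (DL Y n L chi p)].
Proof.
(* the zero matrix is an arbitrary value outside of the boundary *)
have [A hA] : exists A : M -> 'M[R]_7,
    forall p, bdry Y p -> DL_matrix_at Y n L p (A p).
  have hex p : exists A, bdry Y p -> DL_matrix_at Y n L p A.
    have [bp|nbp] := pselect (bdry Y p); last by exists 0.
    by have [A hA] := DL_matrix_exists hY hn hL hLn bp; exists A.
  by exists (fun p => projT1 (cid (hex p))) => p; exact: projT2 (cid (hex p)).
have bA := DL_matrix_bundle hY hn hL hLn hA.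
have DLA psi p : smooth_section Y L psi -> bdry Y p ->
    DL Y n L psi p = psi p *m A p.
  move=> spsi bp; have lpsi := smooth_section_local spsi bp.
  have [v [w [f ->]]] := DLE hY hn bp lpsi.
  exact: hA.
split.
- move=> U1 v1 w1 U2 v2 w2 psi f1 f2 spsi p bp U1p U2p.
  have [_ apsi] := spsi p bp.
  apply: (DL_frame_independent hY hn hL hLn bp _ _ apsi).
    exact: oriented_frame_adapted f1 U1p bp.
  exact: oriented_frame_adapted f2 U2p bp.
- move=> psi spsi p bp; have [bA1 bA2] := bA p bp.
  have [Lp apsi] := spsi p bp; split; first by rewrite DLA// bA1.
  have [Z [sZ hZ]] : smooth_along (bdry Y) p (fun q => psi q *m A q).
    by apply: bA2 apsi _; apply: nearW => q bq; have [] := spsi q bq.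
  exists Z; split => //; apply: filterS hZ => q hq bq.
  by rewrite hq// DLA.
- by exists A; split => // psi spsi p; exact: DLA.
- move=> psi chi spsi schi p bp; have lpsi := smooth_section_local spsi bp.
  have lchi := smooth_section_local schi bp.
  have [v [w [f e1]]] := DLE hY hn bp lpsi.
  have [v' [w' [f' e2]]] := DLE hY hn bp lchi.
  rewrite e1 e2 (DL_frame_independent hY hn hL hLn bp f' f lchi.1).
  exact: (DL_symmetric hY hn hL hLn bp f lpsi lchi).
Qed.
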